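(* For a permutation $w$, the Stanley symmetric function of $w$ is given by $$F_w=\sum_{T\in\mathcal{UIT}(w)}x^{wt(T)},$$ where the sum is over all unbounded inversions tableaux $T$ for $w$.
   Context: Permutations $w\in S_m$ are written in one-line notation $w=w_1\cdots w_m$. $\mathrm{Inv}(w)=\{(i,j): 1\le i<j\le m,\ w_j<w_i\}$ and $l(w)=\#\mathrm{Inv}(w)$. Schubert polynomials: let $\partial_i(f)=\frac{f-s_i(f)}{x_i-x_{i+1}}$, where $s_i(f)$ is obtained from $f$ by swapping $x_i\leftrightarrow x_{i+1}$. The Schubert polynomials $\mathfrak{S}_w$, $w\in S_n$, are uniquely determined by $\mathfrak{S}_{w_0}=x_1^{n-1}x_2^{n-2}\cdots x_{n-1}$, where $w_0=n(n-1)\cdots 21$, and $\partial_i\mathfrak{S}_w=\mathfrak{S}_{ws_i}$ if $l(ws_i)<l(w)$ and $\partial_i\mathfrak{S}_w=0$ otherwise, where $ws_i$ is obtained from $w$ by swapping the entries in positions $i$ and $i+1$. Stanley symmetric function: for $w\in S_m$ let $1^N\times w=1\,2\cdots N\,(w_1+N)\cdots(w_m+N)\in S_{N+m}$. Then $F_w(x_1,x_2,\dots)=\lim_{N\to\infty}\mathfrak{S}_{1^N\times w}(x)$, where both sides are treated as formal power series and the limit is taken coefficientwise. Unbounded inversions tableaux: the staircase consists of the boxes $(i,j)$ with $1\le i<j\le m$ ($i$ the row index, $j$ the column index). The inversions diagram of $w$ is the staircase in which box $(i,j)$ is shaded exactly when $(i,j)\in\mathrm{Inv}(w)$. An unbounded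 inversions tableau for $w$ is an assignment $T$ of a positive integer $T(i,j)$ to each shaded box, with $T(i,j)=0$ for every unshaded box, such that: (IT1) for all $i<j$, $T(i,j)$ is the median (counting multiplicities) of the entries of $T$ in the hook $\{(i,j)\}\cup\{(i',j): i<i'<j\}\cup\{(i,j'): i<j'<j\}$; (IT2) no two shaded boxes in the same column have the same entry. $\mathcal{UIT}(w)$ is the set of these. The weight is $wt(T)=(m_1,m_2,\dots)$, where $m_i$ is the number of boxes with entry $i$ (zeros are not counted), and $x^{wt(T)}=\prod_{i\ge1}x_i^{m_i}$. *)

(* Defs.v *)
From HB Require Import structures.
From mathcomp Require Import all_boot all_order all_algebra all_fingroup.
From mathcomp Require Import finmap mpoly.
From mathcomp Require Import zify ring.
From Stdlib Require Import ClassicalEpsilon.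

Set Implicit Arguments.
Unset Strict Implicit.
Unset Printing Implicit Defensive.

Import GRing.Theory.
Local Open Scope ring_scope.

(* Positions, values and variables are numbered from 0: x_(i+1) is ['X_i], and *)
(* the one-line notation of w is (w 0 + 1) (w 1 + 1) ... (w (m-1) + 1).        *)

Definition inv_set m (w : 'S_m) : {set 'I_m * 'I_m} :=
  [set p : 'I_m * 'I_m | (p.1 < p.2)%N && (w p.2 < w p.1)%N].

Definition len m (w : 'S_m) : nat := #|inv_set w|.

Definition w0 n : 'S_n := perm (@rev_ord_inj n).

(* [(s * w) k = w (s k)] in MathComp, so this exchanges the entries of w in    *)
(* positions i and j: for j = i + 1 it is the permutation usually written      *)
(* w s_i.                                                                      *)
Definition swap n (i j : 'I_n) (w : 'S_n) : 'S_n := (tperm i j * w)%g.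

Fact comm_ring (R : idomainType) (A C p q u v f sf tf su tv stf tsf : R) :
  A != 0 -> C != 0 -> A * p = u - su -> C * q = v - tv ->
  C * u = f - tf -> C * su = sf - stf -> A * v = f - sf -> A * tv = tf - tsf ->
  stf = tsf -> p = q.
Proof.
move=> A0 C0 ep eq eu esu ev etv est.
apply: (mulfI C0); apply: (mulfI A0).
rewrite mulrCA ep eq !mulrBr eu esu ev etv est; ring.
Qed.

Fact braid_ring (R : idomainType)
  (A B C f sf tf stf tsf stsf tstf g g' h h' k k'
   tg sg' stg tsg' sh th' : R) :
  A != 0 -> B != 0 -> C != 0 -> C = A + B ->
  A * g = f - sf -> B * g' = f - tf -> B * h = g - tg -> A * h' = g' - sg' ->
  A * k = h - sh -> B * k' = h' - th' ->
  C * tg = tf - tsf -> C * sg' = sf - stf ->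
  B * stg = stf - stsf -> A * tsg' = tsf - tstf ->
  C * sh = g - stg -> C * th' = g' - tsg' -> stsf = tstf -> k = k'.
Proof.
move=> A0 B0 C0 eC eg eg' eh eh' ek ek' etg esg estg etsg esh eth est.
apply: (mulfI A0); apply: (mulfI B0); apply: (mulfI C0).
have -> : C * (B * (A * k)) = A * g - C * tg + B * stg.
  rewrite ek; transitivity (C * (B * h) - B * (C * sh)); first by ring.
  by rewrite eh esh eC; ring.
have -> : C * (B * (A * k')) = B * g' - C * sg' + A * tsg'.
  transitivity (C * (A * (B * k'))); first by ring.
  rewrite ek'; transitivity (C * (A * h') - A * (C * th')); first by ring.
  by rewrite eh' eth eC; ring.
by rewrite eg eg' etg esg estg etsg est; ring.
Qed.

Fact leibniz_ring (R : comRingType) (a a' b b' : R) :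
  (a - a') * b + a' * (b - b') = a * b - a' * b'.
Proof. ring. Qed.

Section DividedDifference.
Variable n : nat.
Implicit Types (i j k : 'I_n) (f g h : {mpoly int[n]}).

Lemma msymXi (s : 'S_n) i : msym s ('X_i : {mpoly int[n]}) = 'X_(s i).
Proof. by rewrite /msym mmapX mmap1U. Qed.

Lemma divdiff_exists i j f :
  exists g, ('X_i - 'X_j) * g == f - msym (tperm i j) f.
Proof.
pose P f := exists g, ('X_i - 'X_j) * g == f - msym (tperm i j) f.
have PM f1 f2 : P f1 -> P f2 -> P (f1 * f2).
  case=> g1 /eqP e1 [g2 /eqP e2].
  exists (g1 * f2 + msym (tperm i j) f1 * g2); apply/eqP.
  by rewrite mulrDr mulrA e1 mulrCA e2 msymM leibniz_ring.
have P1 : P 1 by exists 0; rewrite mulr0 msym1 subrr.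
have PX k : P 'X_k.
  rewrite /P msymXi; case: tpermP => [->|->|_ _].
  - by exists 1; rewrite mulr1.
  - by exists (-1); rewrite mulrN1 opprB.
  - by exists 0; rewrite mulr0 subrr.
elim/mpolyind: f => [|c m f _ _ [g /eqP eg]].
  by exists 0; rewrite mulr0 msym0 subrr.
have [h /eqP eh] : P 'X_[m].
  rewrite mpolyXE_id; apply: (big_ind P P1 PM) => k _.
  elim: (m k) => [|d IH]; first by rewrite expr0; exact: P1.
  by rewrite exprS; exact: PM.
exists (c *: h + g); apply/eqP.
by rewrite mulrDr -scalerAr eh eg msymD msymZ scalerBr opprD addrACA.
Qed.

(* The quotient (f - s_i f) / (x_i - x_j), s_i exchanging x_i and x_j.         *)
Definition divdiff i j f : {mpoly int[n]} := xchoose (divdiff_exists i j f).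

Lemma divdiffE i j f :
  ('X_i - 'X_j) * divdiff i j f = f - msym (tperm i j) f.
Proof. exact/eqP/(xchooseP (divdiff_exists i j f)). Qed.

End DividedDifference.

Definition is_schubert_family n (S : 'S_n -> {mpoly int[n]}) : Prop :=
  S (w0 n) = \prod_(i < n) 'X_i ^+ (n - i.+1) /\
  forall (w : 'S_n) (i j : 'I_n), j = i.+1 :> nat ->
    divdiff i j (S w) =
      if (len (swap i j w) < len w)%N then S (swap i j w) else 0.

Section SchubertExists.
Variable n : nat.
Implicit Types (i j k a b c d : 'I_n) (f g h : {mpoly int[n]}) (w : 'S_n).

Lemma subX_neq0 i j : i != j -> ('X_i - 'X_j : {mpoly int[n]}) != 0.
Proof.
move=> nij; apply/eqP => /(congr1 (mcoeff U_(i))).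
rewrite mcoeffB !mcoeffX mcoeff0 eqxx.
by case: eqP => // /eqP; rewrite eq_mnm1 eq_sym (negPf nij).
Qed.

Lemma divdiff_sym i j f : i != j ->
  msym (tperm i j) (divdiff i j f) = divdiff i j f.
Proof.
move=> nij; apply: (mulfI (subX_neq0 nij)); rewrite divdiffE.
have := congr1 (msym (tperm i j)) (divdiffE i j f).
rewrite msymM !msymB !msymXi tpermL tpermR -msymMm tperm2 msym1m => e.
by rewrite -[LHS]opprK -mulNr opprB e opprB.
Qed.

Lemma divdiff2 i j f : i != j -> divdiff i j (divdiff i j f) = 0.
Proof.
move=> nij; apply: (mulfI (subX_neq0 nij)).
by rewrite divdiffE divdiff_sym // subrr mulr0.
Qed.

Lemma divdiff_comm a b c d f : a != b -> c != d ->
  a != c -> a != d -> b != c -> b != d ->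
  divdiff a b (divdiff c d f) = divdiff c d (divdiff a b f).
Proof.
move=> ab cd ac ad bc bd.
have e1 : ('X_c - 'X_d) * msym (tperm a b) (divdiff c d f)
   = msym (tperm a b) f - msym (tperm a b) (msym (tperm c d) f).
  by rewrite -msymB -(divdiffE c d f) msymM msymB !msymXi !tpermD.
have e2 : ('X_a - 'X_b) * msym (tperm c d) (divdiff a b f)
   = msym (tperm c d) f - msym (tperm c d) (msym (tperm a b) f).
  by rewrite -msymB -(divdiffE a b f) msymM msymB !msymXi !tpermD // eq_sym.
have e3 : msym (tperm a b) (msym (tperm c d) f)
        = msym (tperm c d) (msym (tperm a b) f).
  rewrite -!msymMm; congr (msym _ _); apply/permP => x; rewrite !permM.
  case: (tpermP a b x) => [->|->|/eqP xa /eqP xb].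
  - by rewrite !(tpermD (x := c)) 1?eq_sym // tpermL.
  - by rewrite !(tpermD (x := c)) 1?eq_sym // tpermR.
  - by case: (tpermP c d x) => [_|_|_ _]; rewrite tpermD // eq_sym.
exact: (comm_ring (subX_neq0 ab) (subX_neq0 cd) (divdiffE a b _)
  (divdiffE c d _) (divdiffE c d _) e1 (divdiffE a b _) e2 e3).
Qed.

Lemma tperm_braid a b d : a != b -> b != d -> a != d ->
  (tperm a b * tperm b d * tperm a b = tperm b d * tperm a b * tperm b d)%g.
Proof.
move=> ab bd ad; apply/permP => x; rewrite !permM.
have Tad : tperm a b d = d by rewrite tpermD // eq_sym.
have Tbd : tperm b d a = a by rewrite tpermD // eq_sym.
have [->|xa] := eqVneq x a; first by rewrite tpermL Tbd !tpermL Tad.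
have [->|xb] := eqVneq x b.
  by rewrite tpermR Tbd !tpermL Tad tpermR.
have [->|xd] := eqVneq x d.
  by rewrite Tad !tpermR Tbd.
by rewrite !tpermD // eq_sym.
Qed.

Lemma divdiff_braid a b d f : a != b -> b != d -> a != d ->
  divdiff a b (divdiff b d (divdiff a b f)) =
  divdiff b d (divdiff a b (divdiff b d f)).
Proof.
move=> ab bd ad.
have Tad : tperm a b d = d by rewrite tpermD // eq_sym.
have Tbd : tperm b d a = a by rewrite tpermD // eq_sym.
pose s := msym (R := int) (tperm a b); pose t := msym (R := int) (tperm b d).
have est : s (t (s f)) = t (s (t f)).
  by rewrite /s /t -!msymMm mulgA tperm_braid // -mulgA.
have sX i j : s ('X_i - 'X_j) = 'X_(tperm a b i) - 'X_(tperm a b j).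
  by rewrite /s msymB !msymXi.
have tX i j : t ('X_i - 'X_j) = 'X_(tperm b d i) - 'X_(tperm b d j).
  by rewrite /t msymB !msymXi.
have sM x y : s (x * y) = s x * s y := msymM _ x y.
have tM x y : t (x * y) = t x * t y := msymM _ x y.
have sB x y : s (x - y) = s x - s y := msymB _ x y.
have tB x y : t (x - y) = t x - t y := msymB _ x y.
pose g := divdiff a b f; pose g' := divdiff b d f.
pose h := divdiff b d g; pose h' := divdiff a b g'.
have eg : ('X_a - 'X_b) * g = f - s f := divdiffE a b f.
have eg' : ('X_b - 'X_d) * g' = f - t f := divdiffE b d f.
have eh : ('X_b - 'X_d) * h = g - t g := divdiffE b d g.
have eh' : ('X_a - 'X_b) * h' = g' - s g' := divdiffE a b g'.
have ek : ('X_a - 'X_b) * divdiff a b h = h - s h := divdiffE a b h.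
have ek' : ('X_b - 'X_d) * divdiff b d h' = h' - t h' := divdiffE b d h'.
have sg : s g = g := divdiff_sym f ab.
have tg' : t g' = g' := divdiff_sym f bd.
change (divdiff a b h = divdiff b d h'); clearbody h h'; clearbody g g'; clearbody s t.
have etg : ('X_a - 'X_d) * t g = t f - t (s f).
  by move: (congr1 t eg); rewrite tM tX Tbd tpermL tB.
have esg : ('X_a - 'X_d) * s g' = s f - s (t f).
  by move: (congr1 s eg'); rewrite sM sX Tad tpermR sB.
have estg : ('X_b - 'X_d) * s (t g) = s (t f) - s (t (s f)).
  by move: (congr1 s etg); rewrite sM sX Tad tpermL sB.
have etsg : ('X_a - 'X_b) * t (s g') = t (s f) - t (s (t f)).
  by move: (congr1 t esg); rewrite tM tX Tbd tpermR tB.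
have esh : ('X_a - 'X_d) * s h = g - s (t g).
  by move: (congr1 s eh); rewrite sM sX Tad tpermR sB sg.
have eth : ('X_a - 'X_d) * t h' = g' - t (s g').
  by move: (congr1 t eh'); rewrite tM tX Tbd tpermL tB tg'.
have eadd : 'X_a - 'X_d = ('X_a - 'X_b) + ('X_b - 'X_d) :> {mpoly int[n]}.
  by rewrite addrA subrK.
exact: (braid_ring (subX_neq0 ab) (subX_neq0 bd) (subX_neq0 ad) eadd
  eg eg' eh eh' ek ek' etg esg estg etsg esh eth est).
Qed.
End SchubertExists.

Section Lengths.
Variable n : nat.
Implicit Types (i j k a b c d : 'I_n) (w : 'S_n).

Lemma swapL i j w : swap i j w i = w j.
Proof. by rewrite permM tpermL. Qed.

Lemma swapR i j w : swap i j w j = w i.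
Proof. by rewrite permM tpermR. Qed.

Lemma swapD i j k w : i != k -> j != k -> swap i j w k = w k.
Proof. by move=> ik jk; rewrite permM tpermD. Qed.

Lemma swapK i j : involutive (swap i j).
Proof. by move=> w; rewrite /swap mulgA tperm2 mul1g. Qed.

Lemma adj_neq i j : j = i.+1 :> nat -> i != j.
Proof. by move=> ij; rewrite -val_eqE /=; lia. Qed.

Lemma adj_tperm_lt i j k l : j = i.+1 :> nat -> (k, l) != (i, j) ->
  (k < l)%N -> (tperm i j k < tperm i j l)%N.
Proof.
move=> ij; rewrite xpair_eqE -!val_eqE /= => nkl kl.
by case: tpermP => [e|e|/eqP + /eqP]; case: tpermP => [e'|e'|/eqP + /eqP];
  rewrite -?val_eqE /=; try subst; lia.
Qed.

Lemma len_swap_up i j w : j = i.+1 :> nat -> (w i < w j)%N ->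
  len (swap i j w) = (len w).+1.
Proof.
move=> ij wij; rewrite /len.
pose f (p : 'I_n * 'I_n) := (tperm i j p.1, tperm i j p.2).
have fK : involutive f by case=> x y; rewrite /f /= !tpermK.
have -> : inv_set (swap i j w) = (i, j) |: f @: inv_set w.
  apply/setP => -[x y]; rewrite in_setU1.
  rewrite (can_imset_pre _ fK) !inE /= !permM.
  have [[-> ->]|nxy] := eqVneq (x, y) (i, j).
    by rewrite tpermL tpermR wij andbT ij ltnS leqnn.
  have [[-> ->]|nyx] := eqVneq (x, y) (j, i).
    by rewrite tpermL tpermR [(w j < _)%N]ltnNge (ltnW wij) !andbF.
  congr (_ && _); apply/idP/idP; first exact: adj_tperm_lt.
  move=> lt; rewrite -(tpermK i j x) -(tpermK i j y).
  apply: adj_tperm_lt lt => //; apply: contraNneq nyx => -[ex ey].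
  by rewrite -(tpermK i j x) -(tpermK i j y) ex ey tpermL tpermR.
rewrite cardsU1 card_imset; last exact: inv_inj.
rewrite (can_imset_pre _ fK) !inE /= tpermL tpermR.
by rewrite ij ltnNge leqnSn.
Qed.

Lemma len_swap_lt i j w : j = i.+1 :> nat ->
  (len (swap i j w) < len w)%N = (w j < w i)%N.
Proof.
move=> ij; case: (ltngtP (w i) (w j)) => [lt|gt|/val_inj/perm_inj e].
- by rewrite len_swap_up // ltnNge leqnSn.
- have := @len_swap_up i j (swap i j w) ij.
  by rewrite swapK swapL swapR => -> //; rewrite ltnSn.
- by move: (adj_neq ij); rewrite e eqxx.
Qed.

Lemma len_le w : (len w <= n * n)%N.
Proof. have -> : (n * n = #|{: 'I_n * 'I_n}|)%N by rewrite card_prod card_ord.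
exact: max_card. Qed.

Definition ascent w (p : 'I_n * 'I_n) : bool :=
  (p.2 == p.1.+1 :> nat) && (w p.1 < w p.2)%N.

Lemma ascent_w0 p : ascent (w0 n) p = false.
Proof.
apply/negP => /andP [/eqP e]; rewrite !permE /= e ltnNge.
by rewrite leq_sub2l.
Qed.

Lemma no_ascent_w0 w : (forall p, ascent w p = false) -> w = w0 n.
Proof.
move=> na.
have desc (k d : nat) i : (i + d)%N = k -> (k < n)%N ->
    forall j, j = k :> nat -> (w j + d <= w i)%N.
  elim: d k => [|d IH] k e lt j ej.
    have -> : j = i by apply: val_inj; rewrite /= ej -e addn0.
    by rewrite addn0.
  have lt' : (i + d < n)%N by lia.
  have {IH} := IH _ erefl lt' (Ordinal lt') erefl.
  have nij : Ordinal lt' != j by rewrite -val_eqE /=; lia.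
  have := na (Ordinal lt', j); rewrite /ascent /= ej -e addnS eqxx /=.
  have : w (Ordinal lt') != w j :> nat by rewrite (inj_eq val_inj) (inj_eq perm_inj).
  lia.
have ub i : (w i <= rev_ord i)%N.
  have lt0 : (0 < n)%N by have := ltn_ord i; lia.
  have := desc i i (Ordinal lt0) (add0n _) (ltn_ord i) i erefl.
  by have := ltn_ord (w (Ordinal lt0)); rewrite /=; lia.
have := leqif_sum (fun i (_ : predT i) => leqif_eq (ub i)).
have -> : (\sum_(i < n) rev_ord i = \sum_(i < n) w i)%N.
  transitivity (\sum_(i < n) i)%N; first by rewrite [RHS](reindex_inj rev_ord_inj).
  by rewrite [LHS](reindex_inj (@perm_inj _ w)).
case=> _; rewrite eqxx => /esym /forallP h.
by apply/permP => i; rewrite permE; apply/val_inj/eqP/(h i).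
Qed.

Fixpoint schubert_fuel (k : nat) w : {mpoly int[n]} :=
  if k is k'.+1 then
    if [pick p | ascent w p] is Some p
    then divdiff p.1 p.2 (schubert_fuel k' (swap p.1 p.2 w))
    else \prod_(i < n) 'X_i ^+ (n - i.+1)
  else \prod_(i < n) 'X_i ^+ (n - i.+1).

Let S w := schubert_fuel (n * n - len w) w.

Lemma ascentP i j w : ascent w (i, j) -> j = i.+1 :> nat /\ (w i < w j)%N.
Proof. by case/andP => /eqP. Qed.

Lemma S_pick w p : [pick p | ascent w p] = Some p ->
  S w = divdiff p.1 p.2 (S (swap p.1 p.2 w)).
Proof.
case: p => i j e.
have [ij wij] : j = i.+1 :> nat /\ (w i < w j)%N.
  by apply: ascentP; case: pickP e => // p ap [<-].
have := len_swap_up ij wij; have := len_le (swap i j w) => le e1.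
rewrite /S (_ : n * n - len w = (n * n - len (swap i j w)).+1)%N; last by lia.
by rewrite /= e.
Qed.

Lemma S_confl (G : 'S_n -> {mpoly int[n]}) w a b c d :
  (forall v p, (len w < len v)%N -> ascent v p ->
     G v = divdiff p.1 p.2 (G (swap p.1 p.2 v))) ->
  ascent w (a, b) -> ascent w (c, d) -> (a < c)%N ->
  divdiff a b (G (swap a b w)) = divdiff c d (G (swap c d w)).
Proof.
move=> IH /ascentP [ab wab] /ascentP [cd wcd] ac.
have nab := adj_neq ab; have ncd := adj_neq cd.
have lab : (len w < len (swap a b w))%N by rewrite len_swap_up.
have lcd : (len w < len (swap c d w))%N by rewrite len_swap_up.
have [ebc|nbc] := eqVneq b c.
  subst c; have nad : a != d by rewrite -val_eqE /=; lia.
  have v1b : swap a b w b = w a by rewrite swapR.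
  have v1d : swap a b w d = w d by rewrite swapD.
  have v2a : swap b d w a = w a by rewrite swapD // eq_sym.
  have v2b : swap b d w b = w d by rewrite swapL.
  have wad : (w a < w d)%N by apply: ltn_trans wab wcd.
  have a1 : ascent (swap a b w) (b, d) by rewrite /ascent /= cd eqxx v1b v1d.
  have a2 : ascent (swap b d w) (a, b) by rewrite /ascent /= ab eqxx v2a v2b.
  rewrite (IH _ _ lab a1) (IH _ _ lcd a2) /=.
  have l1 : (len w < len (swap b d (swap a b w)))%N.
    by rewrite (len_swap_up cd (ascentP a1).2) ltnW.
  have l2 : (len w < len (swap a b (swap b d w)))%N.
    by rewrite (len_swap_up ab (ascentP a2).2) ltnW.
  have a3 : ascent (swap b d (swap a b w)) (a, b).
    by rewrite /ascent /= ab eqxx swapL v1d swapD 1?eq_sym // swapL.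
  have a4 : ascent (swap a b (swap b d w)) (b, d).
    by rewrite /ascent /= cd eqxx swapR v2a swapD // swapR.
  rewrite [X in divdiff a b (divdiff b d X) = _](IH _ _ l1 a3).
  rewrite [X in _ = divdiff b d (divdiff a b X)](IH _ _ l2 a4) /= (divdiff_braid _ nab ncd nad).
  congr (divdiff b d (divdiff a b (divdiff b d (G _)))).
  by rewrite /swap !mulgA tperm_braid.
have nac : a != c by rewrite -val_eqE /=; lia.
have nad : a != d by rewrite -val_eqE /=; lia.
have nbd : b != d by move: nbc; rewrite -!val_eqE /=; lia.
have a1 : ascent (swap a b w) (c, d) by rewrite /ascent /= cd eqxx !swapD.
have a2 : ascent (swap c d w) (a, b).
  by rewrite /ascent /= ab eqxx !swapD // eq_sym.
rewrite (IH _ _ lab a1) (IH _ _ lcd a2) /= (divdiff_comm _ nab ncd nac nad nbc nbd).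
congr (divdiff c d (divdiff a b (G _))); apply/permP => x; rewrite !permM.
congr (w _); case: (tpermP a b x) => [->|->|/eqP xa /eqP xb].
- by rewrite !(tpermD (x := c)) 1?eq_sym // tpermL.
- by rewrite !(tpermD (x := c)) 1?eq_sym // tpermR.
- by case: (tpermP c d x) => [_|_|_ _]; rewrite tpermD // eq_sym.
Qed.

Lemma S_ascent w p : ascent w p -> S w = divdiff p.1 p.2 (S (swap p.1 p.2 w)).
Proof.
have [k le] := ubnP (n * n - len w)%N; elim: k => // k IHk in w p le *.
have IH v q : (len w < len v)%N -> ascent v q ->
    S v = divdiff q.1 q.2 (S (swap q.1 q.2 v)).
  move=> lt; apply: IHk; have := len_le v; lia.
case: p => a b ap; case e : [pick p | ascent w p] => [[c d]|]; last first.
  by move: e; case: pickP => // /(_ (a, b)); rewrite ap.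
have cp : ascent w (c, d) by case: pickP e => // p ? [<-].
rewrite (S_pick e) /=; case: (ltngtP a c) => [lt|gt|/val_inj ac].
- exact/esym/(S_confl IH ap cp lt).
- exact: (S_confl IH cp ap gt).
- subst c; suff -> : b = d by [].
  by apply: val_inj; rewrite /= (ascentP ap).1 (ascentP cp).1.
Qed.

Lemma schubert_family_exists :
  exists S : 'S_n -> {mpoly int[n]}, is_schubert_family S.
Proof.
exists S; split=> [|w i j ij].
  rewrite /S; case: (_ - _)%N => //= k.
  by case: pickP => // p; rewrite ascent_w0.
rewrite len_swap_lt //; case: (ltngtP (w j) (w i)) => [gt|lt|/val_inj/perm_inj e].
- have ap : ascent (swap i j w) (i, j) by rewrite /ascent /= ij eqxx swapL swapR.
  by rewrite (S_ascent ap) /= swapK.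
- have ap : ascent w (i, j) by rewrite /ascent /= ij eqxx.
  by rewrite (S_ascent ap) divdiff2 // adj_neq.
- by move: (adj_neq ij); rewrite e eqxx.
Qed.

Lemma schubert_family_unique (A B : 'S_n -> {mpoly int[n]}) :
  is_schubert_family A -> is_schubert_family B -> A =1 B.
Proof.
move=> hA hB w.
have [k le] := ubnP (n * n - len w)%N; elim: k => // k IHk in w le *.
case: (pickP (ascent w)) => [[i j] /ascentP [ij wij]|/no_ascent_w0 ->]; last first.
  by rewrite (proj1 hA) (proj1 hB).
have lw := len_swap_up ij wij; have lle := len_le (swap i j w).
have step C : is_schubert_family C -> C w = divdiff i j (C (swap i j w)).
  by case=> _ CD; rewrite (CD _ _ _ ij) swapK lw ltnSn.
rewrite (step A hA) (step B hB); congr (divdiff i j _); apply: IHk; lia.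
Qed.
End Lengths.

Definition schubert n : 'S_n -> {mpoly int[n]} :=
  proj1_sig (constructive_indefinite_description _ (@schubert_family_exists n)).

Lemma schubertP n : is_schubert_family (@schubert n).
Proof. by rewrite /schubert; case: constructive_indefinite_description. Qed.

(* 1^N x w: position N + j (j < m) carries the value N + w j.                  *)
Definition shift_fun N m (w : 'S_m) (k : 'I_(N + m)) : 'I_(N + m) :=
  match split k with
  | inl i => lshift m i
  | inr j => rshift N (w j)
  end.

Lemma shift_fun_inj N m (w : 'S_m) : injective (@shift_fun N m w).
Proof.
move=> x y; rewrite /shift_fun.
case: (split_ordP x) => i ->; case: (split_ordP y) => j ->.
- by move=> /lshift_inj ->.
- by move=> /eqP; rewrite eq_lrshift.
- by move=> /eqP; rewrite eq_rlshift.
- by move=> /rshift_inj /perm_inj ->.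
Qed.

Definition shift_perm N m (w : 'S_m) : 'S_(N + m) :=
  perm (@shift_fun_inj N m w).

(* Exponents of the monomials in infinitely many variables x_1, x_2, ...,      *)
(* and formal power series in these variables with integer coefficients,       *)
(* given by their coefficients.                                                *)
Definition expo : Type := {fsfun nat -> nat with 0%N}.
Definition fps : Type := expo -> int.

Definition fps_monomial (e : expo) : fps := fun a => (a == e)%:R.

Definition fps_of_mpoly n (f : {mpoly int[n]}) : fps := fun a =>
  if [forall k : finsupp a, (val k < n)%N] then f@_[multinom a i | i < n] else 0.

Definition fps_lim (f : nat -> fps) (F : fps) : Prop :=
  forall a : expo, exists N0 : nat, forall N : nat, (N0 <= N)%N -> f N a = F a.

(* The possibly infinite sum of the f t over the t satisfying A: every         *)
(* monomial must occur in finitely many of them.                               *)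
Definition fps_sum (I : eqType) (A : I -> Prop) (f : I -> fps) (F : fps) : Prop :=
  forall a : expo, exists s : seq I,
    [/\ uniq s, (forall t, t \in s <-> A t /\ f t a != 0)
      & F a = \sum_(t <- s) f t a].

Lemma fps_lim_unique f F G : fps_lim f F -> fps_lim f G -> F =1 G.
Proof.
move=> hF hG a; have [p hp] := hF a; have [q hq] := hG a.
by rewrite -(hp (maxn p q)) ?leq_maxl // hq ?leq_maxr.
Qed.

Lemma fps_sum_unique (I : eqType) (A : I -> Prop) f F G :
  fps_sum A f F -> fps_sum A f G -> F =1 G.
Proof.
move=> hF hG a; have [s [us ms ->]] := hF a; have [t [ut mt ->]] := hG a.
apply: perm_big; apply: uniq_perm => // x.
by apply/idP/idP; [move/ms/mt | move/mt/ms].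
Qed.

(* Relational, since the limit has to be known to exist; it is then unique.    *)
Definition is_stanley m (w : 'S_m) (F : fps) : Prop :=
  fps_lim (fun N => fps_of_mpoly (schubert (shift_perm N w))) F.

Definition hook_entries m (T : 'M[nat]_m) (i j : 'I_m) : seq nat :=
  T i j :: [seq T i' j | i' : 'I_m <- enum 'I_m & (i < i' < j)%N]
        ++ [seq T i j' | j' : 'I_m <- enum 'I_m & (i < j' < j)%N].

Definition median (s : seq nat) : nat := nth 0%N (sort leq s) (size s)./2.

(* A filling of the staircase is extended by 0 to a full square matrix.        *)
Record is_uit m (w : 'S_m) (T : 'M[nat]_m) : Prop := IsUIT {
  uit_shaded : forall i j, (0 < T i j)%N = ((i, j) \in inv_set w);
  uit_median : forall i j : 'I_m, (i < j)%N ->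
    T i j = median (hook_entries T i j);
  uit_column : forall i i' j, (i, j) \in inv_set w -> (i', j) \in inv_set w ->
    i != i' -> T i j != T i' j
}.

(* An entry k >= 1 contributes the variable x_k, which has index k - 1.        *)
Definition wt m (T : 'M[nat]_m) : expo :=
  [fsfun k in [fset (T p.1 p.2).-1 | p : 'I_m * 'I_m]%fset =>
    #|[set p : 'I_m * 'I_m | T p.1 p.2 == k.+1]| | 0%N].

Lemma wtE m (T : 'M[nat]_m) k :
  wt T k = #|[set p : 'I_m * 'I_m | T p.1 p.2 == k.+1]|.
Proof.
rewrite /wt fsfunE; case: ifPn => // nk; apply/esym/eqP; rewrite cards_eq0.
apply/eqP/setP => p; rewrite !inE; apply/negP => /eqP e.
by case/negP: nk; apply/imfsetP; exists p; rewrite //= e.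
Qed.

(* Main.v *)
Require Import Defs.
From mathcomp Require Import all_boot all_order all_algebra all_fingroup.
From mathcomp Require Import finmap mpoly.
From mathcomp Require Import zify ring.

(** Both sides of the identity count chains of permutations.

    Tableaux. A median of an odd number of entries commutes with every weakly
    increasing map, so T satisfies the median condition if and only if every
    superlevel set {T > c} is a hook majority: it contains a box exactly when
    it contains more than half of the hook of that box. The sets of boxes that
    are hook majorities are the inversion sets of permutations ([triangular]
    is the intermediate condition, on triples of positions; see
    [hook_majority_triangular] and [triangular_perm]). A tableau for w is thus
    a chain w = u_0, u_1, u_2, ... with Inv(u_c) = {T > c} decreasing to the
    empty set, and the column condition says that Inv(u_c) \ Inv(u_(c+1)) has
    at most one box in each column. Such a pair is called a strip below. The
    weight of T records the sizes of these differences, so the number of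
    tableaux of a given weight satisfies the recursion that defines [chains]
    ([size_fillings], [mem_fillings]).

    Schubert polynomials. Variables and generators are numbered from 0. By a
    theorem of Fomin and Stanley, the sum of the Schubert polynomials S_w times
    w, in the nilCoxeter algebra with generators e_0, ..., e_(n-2), is the
    product A_0(x_0) A_1(x_1) ... where
    A_c(x) = (1 + x e_(n-2)) ... (1 + x e_c). The elements A_c(x) and A_c(y)
    commute by the Yang-Baxter relation, which gives the divided difference
    equations ([divdiff_schub_from]); the coefficient of w_0 is a single
    monomial ([schub_from_staircase]). Multiplication by A_c(x) on the left
    expands as a sum over strips ([factors_strips]): a product of distinct
    simple transpositions with decreasing indices creates at most one new
    inversion in each column. Hence the coefficients of S_w count chains of
    strips in which the c-th permutation has no inversion in the first c rows.

    The limit. For 1^N x w this restriction on rows is automatic in the first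
    N steps, and the chains of strips below 1^N x w are those below w
    ([chains_shift]). So the coefficient of x^a in the Schubert polynomial of
    1^N x w does not depend on N once x_0, ..., x_(N-1) contain all variables
    of x^a, and it is then the number of tableaux of weight a. *)

Set Implicit Arguments.
Unset Strict Implicit.
Unset Printing Implicit Defensive.

Import GRing.Theory.
Local Open Scope ring_scope.

(** * Operators of the nilCoxeter algebra *)

Section NilCoxeter.
Variables (k : nat) (R : comNzRingType).
Let n := k.+1.
Implicit Types (f g : {ffun 'S_n -> R}) (w u : 'S_n) (a b c : nat) (x y z : R).

Definition letter a : 'S_n := tperm (inord a) (inord a.+1).

Definition pos w a : 'I_n := (w^-1)%g (inord a).

(** Left multiplication by the generator e_a of the nilCoxeter algebra; an
    element of that algebra is the function of its coefficients. The generator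
    acts on values, so it commutes with the operators acting on positions. *)
Definition peel a f : {ffun 'S_n -> R} :=
  [ffun w => if (pos w a.+1 < pos w a)%N then f (w * letter a)%g else 0].

Definition add_scaled x f g : {ffun 'S_n -> R} := [ffun w => f w + x * g w].

(** Left multiplication by h_a(x) = 1 + x e_a. *)
Definition factor a x f := add_scaled x f (peel a f).

Lemma pos_letter w a b :
  pos (w * letter a) b = (w^-1)%g (letter a (inord b)).
Proof. by rewrite /pos invMg permM tpermV. Qed.

Lemma inord_eq a b : (a < n)%N -> (b < n)%N ->
  (inord a == inord b :> 'I_n) = (a == b).
Proof. by move=> ha hb; rewrite -val_eqE /= !inordK. Qed.

Lemma pos_letterL w a : pos (w * letter a) a = pos w a.+1.
Proof. by rewrite pos_letter tpermL. Qed.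

Lemma pos_letterR w a : pos (w * letter a) a.+1 = pos w a.
Proof. by rewrite pos_letter tpermR. Qed.

Lemma pos_letterD w a b : (a < k)%N -> (b < n)%N -> b != a -> b != a.+1 ->
  pos (w * letter a) b = pos w b.
Proof.
by move=> ha hb h1 h2; rewrite pos_letter tpermD // inord_eq 1?eq_sym //; lia.
Qed.

Lemma peel_add_scaled a x f g :
  peel a (add_scaled x f g) = add_scaled x (peel a f) (peel a g).
Proof. by apply/ffunP => w; rewrite !ffunE; case: ifP => // _; ring. Qed.

Lemma peel2 a f : peel a (peel a f) = [ffun=> 0].
Proof.
apply/ffunP => w; rewrite !ffunE; case: ifP => // h.
by rewrite pos_letterL pos_letterR ltnNge ltnW.
Qed.

Lemma letter_comm a b : (a.+1 < b)%N -> (b < k)%N ->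
  (letter a * letter b = letter b * letter a)%g.
Proof.
move=> ab bk; apply: commute_sym; apply/commgP/conjg_fixP.
by rewrite tpermJ; congr tperm; rewrite tpermD // inord_eq //; lia.
Qed.

Lemma peelC a b f : (a.+1 < b)%N -> (b < k)%N ->
  peel a (peel b f) = peel b (peel a f).
Proof.
move=> ab bk; apply/ffunP => w; rewrite !ffunE.
rewrite !pos_letterD; try lia.
rewrite -!mulgA letter_comm //.
by do 2 case: ifP.
Qed.

Lemma letter_braid a : (a.+1 < k)%N ->
  (letter a * letter a.+1 * letter a = letter a.+1 * letter a * letter a.+1)%g.
Proof. by move=> ak; apply: tperm_braid; rewrite inord_eq //; lia. Qed.

Lemma peel_braid a f : (a.+1 < k)%N ->
  peel a (peel a.+1 (peel a f)) = peel a.+1 (peel a (peel a.+1 f)).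
Proof.
move=> ak; apply/ffunP => w; rewrite !ffunE.
rewrite !(pos_letterL, pos_letterR) !(@pos_letterD _ a a.+2) //; try lia.
rewrite !(@pos_letterD _ a.+1 a) //; try lia.
rewrite !(pos_letterL, pos_letterR).
have -> : (w * letter a * letter a.+1 * letter a =
    w * letter a.+1 * letter a * letter a.+1)%g.
  by rewrite -!mulgA; congr (_ * _)%g; rewrite !mulgA letter_braid.
by do 3 case: ifP => //.
Qed.

Lemma factorD a x y f : factor a x (factor a y f) = factor a (x + y) f.
Proof.
by rewrite /factor !peel_add_scaled peel2; apply/ffunP => w; rewrite !ffunE;
  ring.
Qed.

Lemma factorC a b x y f : (a.+1 < b)%N -> (b < k)%N ->
  factor a x (factor b y f) = factor b y (factor a x f).
Proof.
move=> ab bk; rewrite /factor !peel_add_scaled peelC //.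
by apply/ffunP => w; rewrite !ffunE; ring.
Qed.

Lemma peel0 a : peel a [ffun=> 0] = [ffun=> 0].
Proof. by apply/ffunP => w; rewrite !ffunE if_same. Qed.

(** The Yang-Baxter relation
    h_a(x) h_b(x + z) h_a(z) = h_b(z) h_a(x + z) h_b(x), with b = a + 1,
    multiplied on the right by h_a(x), where z = y - x. *)
Lemma factor_yang_baxter a x y f : (a.+1 < k)%N ->
  factor a x (factor a.+1 y (factor a y f)) =
  factor a.+1 (y - x) (factor a y (factor a.+1 x (factor a x f))).
Proof.
move=> ak; rewrite /factor !peel_add_scaled !peel2 !peel0 -(peel_braid _ ak).
rewrite -!(peel_braid _ ak) !(peel2, peel0).
by apply/ffunP => w; rewrite !ffunE; ring.
Qed.

(** Left multiplication by h_(k-1)(x) ... h_a(x): the factor with the smallest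
    letter acts first. *)
Definition factors a x f := foldl (fun g b => factor b x g) f (iota a (k - a)).

Lemma factors_ge a x f : (k <= a)%N -> factors a x f = f.
Proof. by rewrite /factors -subn_eq0 => /eqP ->. Qed.

Lemma factorsS a x f : (a < k)%N ->
  factors a x f = factors a.+1 x (factor a x f).
Proof. by move=> ak; rewrite /factors (_ : k - a = (k - a.+1).+1)%N //;
  lia. Qed.

Lemma letter_ind (P : nat -> Prop) :
  (forall a, (k <= a)%N -> P a) -> (forall a, (a < k)%N -> P a.+1 -> P a) ->
  forall a, P a.
Proof.
move=> H0 HS a; have [d] := ubnP (k - a)%N; elim: d a => // d IH a ad.
by case: (leqP k a) => [/H0 //|ak]; apply: HS => //; apply: IH; lia.
Qed.

Lemma factor_factors a b x y f : (a.+1 < b)%N ->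
  factor a x (factors b y f) = factors b y (factor a x f).
Proof.
elim/letter_ind: b f => [b bk|b bk IH] f ab;
  first by rewrite !(factors_ge _ _ bk).
by rewrite !(factorsS _ _ bk) IH ?(factorC _ _ _ ab bk) //; lia.
Qed.

Lemma factor0 a f : factor a 0 f = f.
Proof. by apply/ffunP => w; rewrite ffunE mul0r addr0. Qed.

Lemma factors_split a x f : (a < k)%N ->
  factors a.+1 x f = factors a x (factor a (- x) f).
Proof. by move=> ak; rewrite (factorsS _ _ ak) factorD subrr factor0. Qed.

(** One factor h_(a+1)(y - x) produced by the Yang-Baxter relation splits into
    h_(a+1)(y) h_(a+1)(-x): the first completes A_(a+2)(y) to A_(a+1)(y), and
    once A_(a+1)(x) has moved past it, the second reduces A_(a+1)(x) to
    A_(a+2)(x). *)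
Lemma factorsC a x y f :
  factors a x (factors a y f) = factors a y (factors a x f).
Proof.
elim/letter_ind: a f => [a ak|a ak IH] f; first by rewrite !(factors_ge _ _ ak).
have [ak'|ak'] := ltnP a.+1 k; last first.
  by rewrite !(factorsS _ _ ak) !(factors_ge _ _ ak') !factorD addrC.
have step z t g : factor a z (factors a.+1 t g) =
    factors a.+2 t (factor a z (factor a.+1 t g)).
  by rewrite (factorsS _ _ ak') factor_factors.
rewrite !(factorsS _ _ ak) !step factor_yang_baxter // -factorD.
by rewrite -(factorsS y) // IH -factors_split.
Qed.

(** Exchanging x and y in A_a(x) A_(a+1)(y) costs one factor 1 + (y - x) e_a;
    this factor is what a divided difference extracts. *)
Lemma factors_exchange a x y f : (a < k)%N ->
  factors a y (factors a.+1 x f) =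
  factors a x (factors a.+1 y (factor a (y - x) f)).
Proof.
by move=> ak; rewrite !(factors_split _ _ ak) factorD addKr factorsC.
Qed.

Lemma factors_add_scaled a x z f g :
  factors a x (add_scaled z f g) = add_scaled z (factors a x f) (factors a x g).
Proof.
elim/letter_ind: a f g => [a ak|a ak IH] f g;
  first by rewrite !(factors_ge _ _ ak).
rewrite !(factorsS _ _ ak) -IH; congr factors; rewrite /factor peel_add_scaled.
by apply/ffunP => w; rewrite !ffunE; ring.
Qed.

Definition factors_at (X : nat -> R) (s : seq nat) f :=
  foldr (fun a g => factors a (X a) g) f s.

Lemma factors_at_add_scaled X s z f g :
  factors_at X s (add_scaled z f g) =
    add_scaled z (factors_at X s f) (factors_at X s g).
Proof. by elim: s => //= a s ->; rewrite factors_add_scaled. Qed.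

Lemma peel_factors a b x f : (a.+1 < b)%N ->
  peel a (factors b x f) = factors b x (peel a f).
Proof.
elim/letter_ind: b f => [b bk|b bk IH] f ab;
  first by rewrite !(factors_ge _ _ bk).
by rewrite !(factorsS _ _ bk) IH /factor ?peel_add_scaled ?(peelC _ ab bk) //;
  lia.
Qed.

Lemma peel_factors_at X a s f : all (fun b => a.+1 < b)%N s ->
  peel a (factors_at X s f) = factors_at X s (peel a f).
Proof. by elim: s => //= b s IH /andP[ab ?]; rewrite peel_factors // IH. Qed.

(** Right multiplication by a generator, the form in which the divided
    differences act on Schubert polynomials. *)
Definition descend (i j : 'I_n) f : {ffun 'S_n -> R} :=
  [ffun w : 'S_n => if (w j < w i)%N then f (swap i j w) else 0].

Lemma adj_tperm_ltE (i j x y : 'I_n) : j = i.+1 :> nat ->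
  (x, y) != (i, j) -> (x, y) != (j, i) ->
  (tperm i j x < tperm i j y)%N = (x < y)%N.
Proof.
move=> ij nij nji; apply/idP/idP; last exact: adj_tperm_lt.
move=> lt; rewrite -(tpermK i j x) -(tpermK i j y).
apply: adj_tperm_lt => //; apply: contraNneq nji => -[ex ey].
by rewrite -(tpermK i j x) -(tpermK i j y) ex ey tpermL tpermR.
Qed.

(** Left and right multiplications commute. The only delicate case is that of
    positions i, j occupied by the values a, a + 1, where both sides vanish. *)
Lemma peel_descend a (i j : 'I_n) f : (a < k)%N -> j = i.+1 :> nat ->
  peel a (descend i j f) = descend i j (peel a f).
Proof.
move=> ak ij; apply/ffunP => w; rewrite !ffunE.
have posE b : pos (swap i j w) b = tperm i j (pos w b).
  by rewrite /pos /swap invMg tpermV permM.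
rewrite !posE /swap mulgA !permM.
have wp b : w (pos w b) = inord b by rewrite permKV.
have ab : (inord a.+1 : 'I_n) = (inord a : 'I_n).+1 :> nat.
  by rewrite !inordK //; lia.
have nltij : (j < i)%N = false by rewrite ij ltnNge leqnSn.
have nltab : ((inord a.+1 : 'I_n) < (inord a : 'I_n))%N = false.
  by rewrite ab ltnNge leqnSn.
have [[ei ej]|nij] := eqVneq (pos w a.+1, pos w a) (i, j).
  have wi := wp a.+1; have wj := wp a; rewrite {}ei {}ej in wi wj *.
  by rewrite wi wj /letter !(tpermL, tpermR) nltij nltab !if_same.
have [[ej ei]|nji] := eqVneq (pos w a.+1, pos w a) (j, i).
  have wj := wp a.+1; have wi := wp a; rewrite {}ei {}ej in wi wj *.
  by rewrite wi wj nltij nltab.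
rewrite (adj_tperm_ltE ij) // /letter (adj_tperm_ltE ab).
- by do 2 case: ifP.
- by apply: contra_neq nij => -[ej ei]; rewrite /pos -ei -ej !permK.
- by apply: contra_neq nji => -[ej ei]; rewrite /pos -ei -ej !permK.
Qed.

Definition unit_coef : {ffun 'S_n -> R} := [ffun w => (w == 1%g)%:R].

(** Both sides are the coefficients of the generator itself. This turns a left
    multiplication on the right end of the product A_0(x_0) A_1(x_1) ... into
    a right multiplication of the whole product. *)
Lemma peel_unit a (ak : (a < k)%N) :
  peel a unit_coef = descend (inord a) (inord a.+1) unit_coef.
Proof.
apply/ffunP => w; rewrite !ffunE /swap -/(letter a).
have [->|nw] := eqVneq w (letter a).
  by rewrite /pos /letter tpermV !(tpermL, tpermR).
rewrite [(w * _ == 1)%g](_ : _ = false); last first.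
  by apply: contraNF nw => /eqP e; rewrite -(mulgK (letter a) w) e mul1g tpermV.
rewrite [(_ * w == 1)%g](_ : _ = false) ?if_same //.
by apply: contraNF nw => /eqP e; rewrite -(mulKg (letter a) w) e mulg1 tpermV.
Qed.


Lemma factor_descend a x (i j : 'I_n) f : (a < k)%N -> j = i.+1 :> nat ->
  factor a x (descend i j f) = descend i j (factor a x f).
Proof.
move=> ak ij; rewrite /factor peel_descend //; apply/ffunP => w.
by rewrite !ffunE; case: ifP => // _; ring.
Qed.

Lemma factors_at_descend X s (i j : 'I_n) f : j = i.+1 :> nat ->
  factors_at X s (descend i j f) = descend i j (factors_at X s f).
Proof.
move=> ij; elim: s => //= a s ->; move: (factors_at X s f) => {}f.
elim/letter_ind: a f (X a) => [a ak|a ak IH] f x.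
  by rewrite !(factors_ge _ _ ak).
by rewrite !(factorsS _ _ ak) factor_descend.
Qed.

Definition map_coef (s : R -> R) f : {ffun 'S_n -> R} := [ffun w => s (f w)].

Lemma map_coef_factors (s : {rmorphism R -> R}) a x f :
  map_coef s (factors a x f) = factors a (s x) (map_coef s f).
Proof.
elim/letter_ind: a f => [a ak|a ak IH] f; first by rewrite !(factors_ge _ _ ak).
rewrite !(factorsS _ _ ak) IH; congr factors; apply/ffunP => w; rewrite !ffunE.
by rewrite rmorphD rmorphM; case: ifP; rewrite ?rmorph0.
Qed.

Lemma map_coef_factors_at (s : {rmorphism R -> R}) X r f :
  (forall a, a \in r -> s (X a) = X a) ->
  map_coef s (factors_at X r f) = factors_at X r (map_coef s f).
Proof.
elim: r => //= a r IH sX; rewrite map_coef_factors sX ?mem_head // IH //.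
by move=> b br; apply: sX; rewrite inE br orbT.
Qed.

Lemma map_coef_unit (s : {rmorphism R -> R}) :
  map_coef s unit_coef = unit_coef.
Proof. by apply/ffunP => w; rewrite !ffunE rmorph_nat. Qed.

End NilCoxeter.

(** * The generating function of the Schubert polynomials *)

Section SchubertGenerating.
Variable k : nat.
Let n := k.+1.

Definition var a : {mpoly int[n]} := 'X_(inord a).

(** The coefficients of A_c(x_c) A_(c+1)(x_(c+1)) ... A_(n-1)(x_(n-1)). *)
Definition schub_from c : {ffun 'S_n -> {mpoly int[n]}} :=
  factors_at var (iota c (n - c)) (unit_coef k _).

Lemma schub_fromS c : (c < n)%N ->
  schub_from c = factors c (var c) (schub_from c.+1).
Proof. by move=> cn; rewrite /schub_from (_ : n - c = (n - c.+1).+1)%N //;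
  lia. Qed.

(** Only A_a(x_a) A_(a+1)(x_(a+1)) is affected by the exchange of x_a and
    x_(a+1). By [factors_exchange] the difference is (x_a - x_(a+1)) times the
    same product with a generator e_a inserted, and e_a commutes with all
    later factors, hence can be moved to the right end. *)
Lemma divdiff_schub_from (w : 'S_n) (i j : 'I_n) : j = i.+1 :> nat ->
  divdiff i j (schub_from 0 w) = descend i j (schub_from 0) w.
Proof.
move=> ij; have jn := ltn_ord j; pose a := nat_of_ord i.
have nij : i != j by rewrite -val_eqE /= ij; lia.
have ai : inord a = i by rewrite inord_val.
have aj : inord a.+1 = j by apply: val_inj; rewrite /= inordK //; lia.
have ak : (a < k)%N by rewrite /a; lia.
pose s : {rmorphism {mpoly int[n]} -> {mpoly int[n]}} := msym (tperm i j).
have sa : s (var a) = var a.+1 by rewrite /s /= msymXi /var ai aj tpermL.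
have sb : s (var a.+1) = var a by rewrite /s /= msymXi /var ai aj tpermR.
have sD b : (b < n)%N -> b != a -> b != a.+1 -> s (var b) = var b.
  move=> bn ba bb; rewrite /s /= msymXi /var tpermD // -?ai -?aj.
    by rewrite inord_eq ?[_ == b]eq_sym //; lia.
  by rewrite inord_eq ?[_ == b]eq_sym //; lia.
pose rest := schub_from a.+2.
have split0 : schub_from 0 =
    factors_at var (iota 0 a) (factors a (var a) (factors a.+1 (var a.+1)
      rest)).
  have e : iota 0 (n - 0) = iota 0 a ++ [:: a, a.+1 & iota a.+2 (n - a.+2)].
    by rewrite (_ : n - 0 = a + (n - a.+2).+2)%N ?iotaD //; lia.
  by rewrite {1}/schub_from e /factors_at foldr_cat.
have srest : map_coef s rest = rest.
  rewrite map_coef_factors_at ?map_coef_unit // => b.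
  rewrite mem_iota => /andP[h1 h2]; apply: sD; lia.
have prest : peel a rest =
    factors_at var (iota a.+2 (n - a.+2)) (descend i j (unit_coef k _)).
  rewrite peel_factors_at ?peel_unit ?ai ?aj //.
  by apply/allP => b; rewrite mem_iota => /andP[].
(* The last factor has become a right multiplication of the whole product. *)
have sG : map_coef s (schub_from 0) =
    add_scaled (var a.+1 - var a) (schub_from 0) (descend i j (schub_from 0)).
  rewrite {1}split0 map_coef_factors_at; last first.
    by move=> b; rewrite mem_iota => /andP[h1 h2]; apply: sD; lia.
  rewrite !map_coef_factors srest sa sb factors_exchange //.
  rewrite !factors_add_scaled factors_at_add_scaled -split0 prest;
    congr add_scaled.
  have fd x b f : factors b x (descend i j f) = descend i j (factors b x f).
    exact: (@factors_at_descend _ _ (fun=> x) [:: b]).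
  by rewrite factors_at_descend // !fd factors_at_descend // -split0.
apply: (mulfI (subX_neq0 nij)); rewrite divdiffE.
have := congr1 (fun f : {ffun _} => f w) sG; rewrite !ffunE /= => ->.
by rewrite /var ai aj; ring.
Qed.
End SchubertGenerating.

(** * Hook medians and inversion sets *)

Lemma count_enum_set (T : finType) (Q : pred T) :
  count Q (enum T) = #|[set x | Q x]|.
Proof.
rewrite cardsE cardE /enum_mem size_filter count_filter.
by apply: eq_count => x /=; rewrite andbT.
Qed.

Section InversionSets.
Variable m : nat.
Implicit Types (D : rel 'I_m) (w u v : 'S_m) (i j k : 'I_m).

Lemma mem_inv w i j : ((i, j) \in inv_set w) = (i < j)%N && (w j < w i)%N.
Proof. by rewrite inE. Qed.

Lemma perm_lt_total w i j : i != j -> (w j < w i)%N = ~~ (w i < w j)%N.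
Proof.
move=> nij; have : w i != w j :> nat.
  by rewrite (inj_eq val_inj) (inj_eq perm_inj).
lia.
Qed.

Lemma card_interval (a b : nat) : (b <= m)%N ->
  #|[set i : 'I_m | (a <= i < b)%N]| = (b - a)%N.
Proof.
move=> bm; rewrite -sum1dep_card big_mkcond /=.
rewrite -(big_mkord xpredT (fun x => if (a <= x < b)%N then 1%N else 0%N)).
rewrite -big_mkcond sum1_count /index_iota subn0.
case: (leqP a b) => [ab|ba]; last first.
  rewrite (@eq_count _ _ pred0) ?count_pred0 => [|x]; rewrite /=; lia.
rewrite (_ : m = a + (b - a) + (m - b))%N; last by lia.
rewrite !iotaD !count_cat !add0n.
rewrite (@eq_in_count _ _ pred0 (iota 0 a)); last first.
  by move=> x; rewrite mem_iota /=; lia.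
rewrite (@eq_in_count _ _ predT (iota a _)); last first.
  by move=> x; rewrite mem_iota /=; lia.
rewrite (@eq_in_count _ _ pred0 (iota _ (m - b))); last first.
  by move=> x; rewrite mem_iota /=; lia.
by rewrite !count_pred0 count_predT size_iota addn0.
Qed.

(** A permutation is determined by its inversion set: this formula expresses
    its values by comparisons, which [perm_lt_inv] reads off that set. *)
Lemma perm_rank w i : w i = #|[set j | (w j < w i)%N]| :> nat.
Proof.
have -> : [set j | (w j < w i)%N] = w @^-1: [set y : 'I_m | (0 <= y < w i)%N].
  by apply/setP => j; rewrite !inE.
by rewrite card_preimset ?card_interval ?subn0 ?(ltnW (ltn_ord _)) //;
  apply: perm_inj.
Qed.

Lemma perm_lt_inv w i j : (w j < w i)%N =
  if (i < j)%N then (i, j) \in inv_set w else (j < i)%N &&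
    ((j, i) \notin inv_set w).
Proof.
rewrite !mem_inv; case: (ltngtP i j) => [//|ji|/val_inj ->];
  last by rewrite ltnn.
by rewrite perm_lt_total //= -val_eqE /=; lia.
Qed.

Lemma inv_set_inj : injective (@inv_set m).
Proof.
move=> w u e; apply/permP => i; apply: val_inj;
  rewrite /= (perm_rank w) (perm_rank u).
by apply: eq_card => j; rewrite !inE !perm_lt_inv e.
Qed.

Lemma inv_set1 : inv_set (1 : 'S_m)%g = set0.
Proof. by apply/setP => -[i j]; rewrite mem_inv !perm1 in_set0; lia. Qed.

(** Transitivity of D and of its complement, the known characterization of
    inversion sets. For a superlevel set of T it says that T i j lies between
    T i k and T k j. *)
Definition triangular D := forall i k j, (i < k)%N -> (k < j)%N ->
  (D i k -> D k j -> D i j) /\ (D i j -> D i k || D k j).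

Lemma triangular_inv_set w : triangular (fun i j => (i, j) \in inv_set w).
Proof. move=> i k j ik kj; rewrite !mem_inv; split; lia. Qed.

Definition hook_count D i j : nat :=
  (D i j + #|[set k : 'I_m | (i < k < j)%N && D k j]|
         + #|[set k : 'I_m | (i < k < j)%N && D i k]|)%N.

(** The hook of (i, j) has 2 (j - i) - 1 boxes, so a majority is j - i. *)
Definition hook_majority D :=
  forall i j, (i < j)%N -> D i j = (j - i <= hook_count D i j)%N.

Lemma card_between i j : #|[set k : 'I_m | (i < k < j)%N]| = (j - i.+1)%N.
Proof. by rewrite card_interval // ltnW. Qed.

(** For each k between i and j, at least one of the boxes (k, j), (i, k) is in
    D if (i, j) is, and at most one if (i, j) is not. *)
Lemma triangular_hook_majority D : triangular D -> hook_majority D.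
Proof.
move=> tD i j ij; rewrite /hook_count.
set A := [set k : 'I_m | _ && D k j]; set B := [set k : 'I_m | _ && D i k].
have UE : (#|A| + #|B| = #|A :|: B| + #|A :&: B|)%N by rewrite -cardsUI.
have sU : A :|: B \subset [set k : 'I_m | (i < k < j)%N].
  by apply/subsetP => k; rewrite !inE; case/orP => /andP[].
have := subset_leq_card sU; rewrite card_between => le1.
case Dij: (D i j).
  have eU : A :|: B = [set k : 'I_m | (i < k < j)%N].
    apply/setP => k; rewrite !inE -andb_orr; apply: andb_idr => /andP[ik kj].
    by have [_ /(_ Dij)] := tD _ _ _ ik kj; rewrite orbC.
  by rewrite eU card_between in UE; lia.
have I0 : A :&: B = set0.
  apply/setP => k; rewrite !inE; apply/negP => /andP[/andP[/andP[ik kj] Dkj]].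
  by case/andP=> _ Dik; have [/(_ Dik Dkj)] := tD _ _ _ ik kj; rewrite Dij.
by rewrite I0 cards0 in UE; lia.
Qed.

(** By induction on j - i the positions strictly between i and j are linearly
    ordered, and so are they together with i, and together with j. Let L be the
    set of those that lie below i and U the set of those that lie below j. Both
    are initial segments, so they are nested, and the majority condition on the
    hook of (i, j) compares their sizes: it puts (i, j) in D if U is strictly
    contained in L, and outside D if L is strictly contained in U. *)
Lemma hook_majority_triangular D : hook_majority D -> triangular D.
Proof.
move=> hD i k j; have [d] := ubnP (j - i)%N.
elim: d => // d IH in i k j *; rewrite ltnS => jid ik kj.
have ij := ltn_trans ik kj.
pose L := [set l : 'I_m | (i < l < j)%N && D i l].
pose U := [set l : 'I_m | (i < l < j)%N && ~~ D l j].
(* L and U are initial segments of the linear order strictly between i and j. *)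
have nested x y : x \in U -> x \notin L -> y \in L -> y \in U.
  rewrite !inE => /andP[/andP[ix xj] nxj]; rewrite ix xj /= => nix.
  case/andP=> /andP[iy yj] iy'; rewrite iy yj /=; apply/negP => yj'.
  case: (ltngtP x y) => [xy|yx|/val_inj exy].
  - have [|_ /(_ iy')] := IH i x y _ ix xy; first by lia.
    rewrite (negPf nix) /= => xy'.
    have [|/(_ xy' yj')] := IH x y j _ xy yj; first by lia.
    by rewrite (negPf nxj).
  - have [|h _] := IH i y x _ iy yx; first by lia.
    have [|_ /(_ yj')] := IH y x j _ yx xj; first by lia.
    by rewrite (negPf nxj) orbF => /(h iy'); rewrite (negPf nix).
  - by move: nix; rewrite exy iy'.
have cU : (#|U| + #|[set l : 'I_m | (i < l < j)%N && D l j]| = j - i.+1)%N.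
  rewrite -card_between addnC.
  rewrite -(cardsID [set l : 'I_m | D l j] [set l : 'I_m | (i < l < j)%N]).
  by congr (_ + _)%N; apply: eq_card => l; rewrite !inE // andbC.
have LU : L \subset U \/ U \subset L.
  case: (boolP (U \subset L)) => [|/subsetPn[x xU xL]]; [by right | left].
  by apply/subsetP => y; apply: nested xU xL.
have kL : (k \in L) = D i k by rewrite inE ik kj.
have kU : (k \in U) = ~~ D k j by rewrite inE ik kj.
have hDij := hD _ _ ij; rewrite /hook_count -/L in hDij; split.
  move=> Dik Dkj; case: LU => [/subsetP/(_ k)|sUL].
    by rewrite kL kU Dkj => /(_ Dik).
  have /proper_card : U \proper L.
    by apply/properP; split=> //; exists k; rewrite ?kL ?kU ?Dkj.
  by move=> lt; rewrite hDij; lia.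
move=> Dij; apply: contraLR Dij; rewrite negb_or => /andP[nDik nDkj].
have /proper_card : L \proper U.
  apply/properP; split; last by exists k; rewrite ?kL ?kU.
  by case: LU => // /subsetP/(_ k); rewrite kL kU => /(_ nDkj);
    rewrite (negPf nDik).
by move=> lt; apply/negP => Dij; move: hDij; rewrite Dij => /esym; lia.
Qed.

Lemma count_sorted_nth (c : nat) (s : seq nat) (i : nat) : sorted leq s ->
  (i < size s)%N ->
  (c < nth 0 s i)%N = (size s - i <= count (fun x => c < x) s)%N.
Proof.
move=> ss si; have cs := count_predC (fun x => c < x)%N s.
have e : count (predC (fun x => c < x)%N) s = count (fun x => x <= c)%N s.
  by apply: eq_count => x /=; rewrite -leqNgt.
rewrite {}e in cs; apply/idP/idP => h.
  suff le : (count (fun x => x <= c)%N s <= i)%N by lia.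
  rewrite leqNgt; apply: contraL h => h; rewrite -leqNgt.
  exact: (@Order.POrderTheory.nth_count_le _ nat c 0%N s i ss h).
apply: (@Order.TotalTheory.DualTotalTheory.nth_count_gt _ nat c 0%N s i ss).
by apply/andP; split => //; change (count (fun x => x <= c)%N s <= i)%N; lia.
Qed.

Lemma median_hook (T : 'M[nat]_m) c i j : (i < j)%N ->
  (c < median (hook_entries T i j))%N =
  (j - i <= hook_count (fun i j => c < T i j)%N i j)%N.
Proof.
move=> ij; rewrite /median /hook_entries.
set s := (_ :: _).
have cnt (P : pred 'I_m) (f : 'I_m -> nat) :
    (count (fun x => c < x)%N [seq f x | x <- enum 'I_m & P x] =
    #|[set x | P x && (c < f x)%N]|)%N.
  rewrite count_map count_filter count_enum_set.
  by apply: eq_card => x; rewrite !inE /= andbC.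
have sz (P : pred 'I_m) (f : 'I_m -> nat) :
    size [seq f x | x <- enum 'I_m & P x] = #|[set x | P x]|.
  by rewrite size_map size_filter count_enum_set.
have ss : (size s = (j - i.+1).*2.+1)%N.
  by rewrite /s /= size_cat !sz card_between addnn.
have h1 : sorted leq (sort leq s) := sort_sorted leq_total s.
have h2 : ((size s)./2 < size (sort leq s))%N by rewrite size_sort ss; lia.
rewrite (count_sorted_nth _ h1 h2) size_sort ss.
rewrite count_sort /s /= count_cat !cnt /hook_count addnA.
by rewrite [X in (X <= _)%N](_ : _ = (j - i)%N) //; lia.
Qed.

(** Two numbers are equal if and only if they exceed the same c; this reduces
    the median condition to superlevel sets. *)
Lemma median_triangular (T : 'M[nat]_m) :
  (forall i j : 'I_m, (i < j)%N -> T i j = median (hook_entries T i j)) <->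
  (forall c, triangular (fun i j => c < T i j)%N).
Proof.
split=> [hT c | hT i j ij].
  apply: hook_majority_triangular => i j ij; rewrite -median_hook //.
  by rewrite -hT.
have key c : (c < T i j)%N = (c < median (hook_entries T i j))%N.
  by rewrite median_hook //; exact: (triangular_hook_majority (hT c)).
apply/eqP; rewrite eqn_leq; apply/andP; split.
  by rewrite leqNgt key ltnn.
by rewrite leqNgt -key ltnn.
Qed.

(** D prescribes which of two positions carries the smaller value. The two
    transitivity conditions make this a strict linear order on positions, and
    the permutation is the rank in that order. *)
Lemma triangular_perm D : triangular D ->
  exists w : 'S_m, forall i j, (i < j)%N -> ((i, j) \in inv_set w) = D i j.
Proof.
move=> tD; pose below i j := if (i < j)%N then D i j else (j < i)%N && ~~ D j i.
have below_irr i : below i i = false by rewrite /below ltnn.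
have below_asym i j : i != j -> below i j = ~~ below j i.
  by rewrite /below -val_eqE /=; case: (ltngtP i j) => //=; rewrite negbK.
have below_trans i j l : below i j -> below j l -> below i l.
  rewrite /below; case: (ltngtP i j) => [ij|ji|//];
    case: (ltngtP j l) => [jl|lj|//].
  - by rewrite (ltn_trans ij jl); case: (tD _ _ _ ij jl).
  - move=> h1 h2; case: (ltngtP i l) => [il|li|/val_inj e] /=.
    + by case: (tD _ _ _ il lj) => _ /(_ h1); rewrite (negPf h2) orbF.
    + by apply: contraNN h2 => h3; case: (tD _ _ _ li ij) => /(_ h3 h1).
    + by rewrite -e h1 in h2.
  - move=> h1 h2; case: (ltngtP i l) => [il|li|/val_inj e] /=.
    + by case: (tD _ _ _ ji il) => _ /(_ h2); rewrite (negPf h1).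
    + by apply: contraNN h1 => h3; case: (tD _ _ _ jl li) => /(_ h2 h3).
    + by rewrite e h2 in h1.
  - rewrite ltnNge (ltnW (ltn_trans lj ji)) (ltn_trans lj ji) /= => h1 h2.
    by apply/negP => h3; case: (tD _ _ _ lj ji) => _ /(_ h3);
      rewrite (negPf h1) (negPf h2).
pose rk i := #|[set j | below i j]|.
have rk_mono i j : below i j -> (rk j < rk i)%N.
  move=> bij; apply: proper_card; apply/properP; split.
    by apply/subsetP => l; rewrite !inE; apply: below_trans.
  by exists j; rewrite !inE ?below_irr.
have rk_lt i : (rk i < m)%N.
  rewrite -[X in (_ < X)%N]card_ord; apply: proper_card; apply/properP.
  by split; [apply/subsetP | exists i; rewrite ?inE ?below_irr].
have rk_inj : injective (fun i => Ordinal (rk_lt i)).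
  move=> i j [e]; apply/eqP/negPn/negP => nij.
  have [/rk_mono|] := boolP (below i j); first by rewrite e ltnn.
  by rewrite below_asym // negbK => /rk_mono; rewrite e ltnn.
exists (perm rk_inj) => i j ij; rewrite mem_inv ij !permE /=.
have <- : below i j = D i j by rewrite /below ij.
apply/idP/idP => [|/rk_mono //]; apply: contraTT; rewrite -leqNgt => nb.
by apply/ltnW/rk_mono; rewrite below_asym // -val_eqE /=; lia.
Qed.
End InversionSets.

(** * Expansion over strips *)

Section Strips.
Variable m : nat.
Implicit Types u w v : 'S_m.

Definition column_injective (A : {set 'I_m * 'I_m}) :=
  [forall p in A, forall q in A, (p.2 == q.2) ==> (p.1 == q.1)].

Lemma column_injectiveP (A : {set 'I_m * 'I_m}) :
  reflect (forall i i' j, (i, j) \in A -> (i', j) \in A ->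
    i = i') (column_injective A).
Proof.
apply: (iffP forall_inP) => [h i i' j ij i'j | h [i j] ij].
  by have /forall_inP/(_ _ i'j)/implyP/(_ (eqxx _))/eqP := h _ ij.
by apply/forall_inP => -[i' j'] ij'; apply/implyP => /= /eqP e; subst;
  apply/eqP; apply: h ij'.
Qed.

Lemma column_injectiveS (A B : {set 'I_m * 'I_m}) :
  A \subset B -> column_injective B -> column_injective A.
Proof.
move=> /subsetP AB /column_injectiveP h;
  apply/column_injectiveP => i i' j /AB ij /AB.
exact: h ij.
Qed.

(** These are the steps of the chain of superlevel sets of a tableau: the boxes
    with the smallest entry are removed, and there is at most one of them in
    each column. *)
Definition strip u w :=
  (inv_set u \subset inv_set w) && column_injective (inv_set w :\: inv_set u).

Lemma strip_refl w : strip w w.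
Proof.
by rewrite /strip subxx setDv; apply/column_injectiveP => i i' j; rewrite inE.
Qed.

Definition agree (a : nat) u w :=
  [forall x : 'I_m, (x < a)%N ==> ((u^-1)%g x == (w^-1)%g x)].

Lemma agreeP a u w :
  reflect (forall x : 'I_m, (x < a)%N -> (u^-1)%g x = (w^-1)%g x) (agree a u w).
Proof.
apply: (iffP forall_inP) => h x xa; first exact/eqP/h.
by apply/eqP/h.
Qed.

Lemma agree_sym a u w : agree a u w = agree a w u.
Proof. by apply: eq_forallb => x; rewrite eq_sym. Qed.

Lemma agree_val a u w y : agree a u w -> (u y < a)%N -> w y = u y :> nat.
Proof.
by move=> /agreeP h ua; have := h _ ua; rewrite permK => e; rewrite {1}e permKV.
Qed.
End Strips.

Section Expansion.
Variables (k : nat) (R : comNzRingType).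
Let n := k.+1.
Implicit Types (f : {ffun 'S_n -> R}) (u v w : 'S_n) (a : nat).

Lemma inv_set_letter a w : (a < k)%N -> (pos w a < pos w a.+1)%N ->
  inv_set (w * letter k a)%g = (pos w a, pos w a.+1) |: inv_set w.
Proof.
move=> ak lt; apply/setP => -[i j]; rewrite in_setU1 !mem_inv !permM /letter.
have ab : (inord a.+1 : 'I_n) = (inord a : 'I_n).+1 :> nat.
  by rewrite !inordK //; lia.
have wp b : w (pos w b) = inord b by rewrite permKV.
have [[-> ->]|nij] := eqVneq (i, j) (pos w a, pos w a.+1).
  by rewrite !wp tpermL tpermR lt ab leqnn.
have [[-> ->]|nji] := eqVneq (i, j) (pos w a.+1, pos w a).
  by rewrite ltnNge (ltnW lt).
rewrite (adj_tperm_ltE ab) //.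
- by apply: contra_neq nji => -[ej ei]; rewrite /pos -ei -ej !permK.
- by apply: contra_neq nij => -[ej ei]; rewrite /pos -ei -ej !permK.
Qed.

Lemma pos_notin_inv_set a w : (a < k)%N ->
  (pos w a, pos w a.+1) \notin inv_set w.
Proof.
move=> ak; rewrite mem_inv !permKV negb_and -!leqNgt !inordK //; try lia.
Qed.

(** The condition under which w is the composite of u followed by a product of
    simple transpositions of values, with increasing letters that are all at
    least a, each of which creates an inversion. *)
Definition strip_from a u w := strip u w && agree a u w.

Lemma strip_from_last u w a : (k <= a)%N -> strip_from a u w = (u == w).
Proof.
move=> ka; apply/idP/eqP => [/andP[_ h]|->]; last first.
  by rewrite /strip_from strip_refl; apply/agreeP.
apply/permP => y.
have [ya|ya] := ltnP (u y) a; first by apply: val_inj; rewrite /= (agree_val h).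
have [wa|wa] := ltnP (w y) a.
  by rewrite agree_sym in h; apply: val_inj; rewrite /= (agree_val h).
have hu : (u y <= k)%N := ltn_ord (u y).
have hw : (w y <= k)%N := ltn_ord (w y).
by apply: val_inj; rewrite /=; lia.
Qed.

Lemma agreeS a u w : (a < n)%N ->
  agree a.+1 u w = agree a u w && (pos u a == pos w a).
Proof.
move=> an; apply/agreeP/andP => [h|[/agreeP h /eqP e] x].
  split; last by apply/eqP; apply: h; rewrite inordK.
  by apply/agreeP => x xa; apply: h; lia.
rewrite ltnS leq_eqVlt => /orP[/eqP xa|]; last exact: h.
by move: e; rewrite /pos -xa inord_val.
Qed.

Lemma strip_fromS a u w : (a < k)%N ->
  strip_from a u w && (pos u a == pos w a) = strip_from a.+1 u w.
Proof. by move=> ak; rewrite /strip_from agreeS ?andbA // ltnW. Qed.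

(** The product of decreasing letters in a strip uses the letter a exactly when
    the value a changes position, and this letter then acts on u first.
    From left to right: let the values a of u and w be in positions p and q.
    Every value of u from a up to u q - 1 has to give an inversion in column q
    that is new in w; there is only one such inversion, so u q = a + 1. From
    right to left: w and u * letter k a have the value a in position q, so no
    further inversion in column q can be created. *)
Lemma strip_from_letter a u w : (a < k)%N ->
  strip_from a u w && (pos u a != pos w a) =
  strip_from a.+1 (u * letter k a)%g w && (pos u a < pos u a.+1)%N.
Proof.
move=> ak.
have an : (a < n)%N by apply: ltnW.
apply/idP/idP => /andP[].
  move=> /andP[/andP[sub cf] ag] npos; have gu := agree_val ag.
  have gw y : (w y < a)%N -> u y = w y :> nat by apply: agree_val;
    rewrite agree_sym.
  set p := pos u a in npos *; set q := pos w a in npos *.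
  have up : u p = a :> nat by rewrite permKV inordK.
  have wq : w q = a :> nat by rewrite permKV inordK.
  have uq : (a < u q)%N.
    have uqp : u q != u p :> nat.
      by rewrite (inj_eq val_inj) (inj_eq perm_inj) eq_sym.
    have := gu q; rewrite wq; case: (ltngtP (u q) a) => // [lt|e].
      by move=> /(_ isT) e; rewrite -e ltnn in lt.
    by rewrite e up eqxx in uqp.
  have new r : (a <= u r)%N -> (u r < u q)%N ->
    (r, q) \in inv_set w :\: inv_set u.
    move=> ar rq; rewrite inE !mem_inv.
    have nrq : r != q by apply: contraTneq rq => ->; rewrite ltnn.
    have wrq : w r != w q :> nat by rewrite (inj_eq val_inj) (inj_eq perm_inj).
    have wr : (a < w r)%N.
      case: (ltngtP (w r) a) => // [lt|e]; last by rewrite e wq eqxx in wrq.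
      by have := gw r lt => e; rewrite e leqNgt lt in ar.
    have ltrq : (r < q)%N.
      case: (ltngtP r q) => // [qr|/val_inj e]; last by rewrite e eqxx in nrq.
      have : (q, r) \in inv_set u by rewrite mem_inv qr.
      move/(subsetP sub); rewrite mem_inv wq => /andP[_].
      by rewrite ltnNge ltnW.
    by rewrite ltrq wq wr /= -leqNgt ltnW.
  pose r := pos u a.+1; have ur : u r = a.+1 :> nat by rewrite permKV inordK.
  have pq := new p; rewrite up leqnn uq in pq; have {}pq := pq isT isT.
  have rq : r = q.
    apply: contraTeq uq => nrq.
    have uqr : u q != u r :> nat.
      by rewrite (inj_eq val_inj) (inj_eq perm_inj) eq_sym.
    rewrite -leqNgt leqNgt; apply/negP => uq.
    have rq : (r, q) \in inv_set w :\: inv_set u by apply: new; lia.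
    have := column_injectiveP _ cf _ _ _ pq rq => epr.
    by move: up; rewrite epr ur; lia.
  have lt : (p < q)%N by move: pq; rewrite inE !mem_inv => /andP[_ /andP[]].
  have e : inv_set (u * letter k a)%g = (p, q) |: inv_set u.
    by rewrite inv_set_letter // -/p -/r rq.
  rewrite -/r rq lt andbT /strip_from agreeS // /strip e pos_letterL -/r rq
    eqxx.
  rewrite andbT; apply/andP; split; [apply/andP; split|].
  - rewrite subUset sub1set sub andbT.
    by move: pq; rewrite inE => /andP[].
  - by apply: column_injectiveS cf; rewrite setDS // subsetUr.
  - apply/agreeP => x xa;
    rewrite invMg tpermV permM tpermD ?(agreeP _ _ _ ag) //.
      by rewrite -val_eqE /= inordK //; lia.
    by rewrite -val_eqE /= inordK //; lia.
set v := (u * letter k a)%g.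
move=> /andP[/andP[sub cf]];
  rewrite agreeS // pos_letterL => /andP[ag /eqP pq] lt.
have gv := agree_val ag.
set p := pos u a in lt *; set q := pos u a.+1 in pq lt *.
have wq : w q = a :> nat by rewrite pq permKV inordK.
have vq : v q = a :> nat by rewrite /v permM permKV tpermR inordK.
have e : inv_set v = (p, q) |: inv_set u by rewrite inv_set_letter.
have npq : (p, q) \notin inv_set u by exact: pos_notin_inv_set.
rewrite -pq neq_ltn lt andbT /strip_from /strip -andbA; apply/and3P; split.
- by apply: subset_trans sub; rewrite e subsetUr.
- have new r : (r, q) \in inv_set w :\: inv_set u -> r = p.
    rewrite inE => /andP[nu inw]; apply: contraNeq nu => nrp.
    have: (r, q) \in inv_set v; last first.
      by rewrite e inE => /orP[|//]; rewrite inE xpair_eqE (negPf nrp).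
    move: inw; rewrite !mem_inv => /andP[-> wlt] /=; rewrite vq.
    have nrq : v r != v q :> nat.
      rewrite (inj_eq val_inj) (inj_eq perm_inj); apply: contraTneq wlt => ->.
      by rewrite ltnn.
    case: (ltngtP (v r) a) => // [h|h]; last by rewrite h vq eqxx in nrq.
    by rewrite (gv _ h) wq in wlt; lia.
  have old i j : (i, j) \in inv_set w :\: inv_set u -> j != q ->
      (i, j) \in inv_set w :\: inv_set v.
    rewrite !inE => /andP[nu ->] nj; rewrite andbT; apply: contraNN nu.
    by rewrite -mem_inv e inE inE xpair_eqE (negPf nj) andbF -mem_inv.
  apply/column_injectiveP => i i' j ij i'j.
  have [ejq|nj] := eqVneq j q; first by subst j; rewrite (new _ ij) (new _ i'j).
  exact: (column_injectiveP _ cf _ _ _ (old _ _ ij nj) (old _ _ i'j nj)).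
- apply/agreeP => x xa;
  rewrite -(agreeP _ _ _ ag) // invMg tpermV permM tpermD //.
    by rewrite -val_eqE /= inordK //; lia.
  by rewrite -val_eqE /= inordK //; lia.
Qed.

(** The terms are split according to whether the letter a is used; the terms
    that use it are reindexed by the involution u |-> u * letter k a. *)
Lemma factors_strips a x f w :
  factors a x f w =
  \sum_(u | strip_from a u w) x ^+ #|inv_set w :\: inv_set u| * f u.
Proof.
elim/(@letter_ind k): a f => [a ak|a ak IH] f.
  rewrite factors_ge // (big_pred1 w) => [|u]; last exact: strip_from_last.
  by rewrite setDv cards0 mul1r.
rewrite factorsS // IH [RHS](bigID (fun u => pos u a == pos w a)) /=.
rewrite (eq_bigl _ _ (fun u => strip_fromS u w ak)).
rewrite (eq_bigl _ _ (fun u => strip_from_letter u w ak)).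
have lI (u : 'S_n) : (u * letter k a * letter k a = u)%g.
  by rewrite -mulgA tperm2 mulg1.
rewrite [X in _ = _ + X](reindex_inj (mulIg (letter k a))) /=.
rewrite (eq_bigr (fun u => x ^+ #|inv_set w :\: inv_set u| * f u +
   if (pos u a.+1 < pos u a)%N then
     x ^+ #|inv_set w :\: inv_set u|.+1 * f (u * letter k a)%g else 0));
       last first.
  move=> u _; rewrite !ffunE mulrDr; congr (_ + _).
  by case: ifP => _; rewrite ?mulr0 // exprSr mulrA.
rewrite big_split /= -big_mkcondr; congr (_ + _).
rewrite [RHS](eq_bigl (fun u => strip_from a.+1 u w &&
  (pos u a.+1 < pos u a)%N)); last first.
  by move=> u; rewrite lI pos_letterL pos_letterR.
apply: eq_bigr => u /andP[/andP[/andP[sub _] _] lt]; congr (x ^+ _ * _).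
have := @inv_set_letter a (u * letter k a)%g ak.
rewrite pos_letterL pos_letterR lI => /(_ lt) e.
have nin := @pos_notin_inv_set a (u * letter k a)%g ak.
rewrite pos_letterL pos_letterR in nin.
rewrite (_ : _ :\: inv_set (u * letter k a)%g =
  (pos u a.+1, pos u a) |: (inv_set w :\: inv_set u)).
  rewrite cardsU1 inE e inE set11 /= add1n //.
apply/setP => p; rewrite e !inE negb_or.
have [->|//] := eqVneq p (pos u a.+1, pos u a).
rewrite /= -mem_inv nin /=.
have := subsetP sub (pos u a.+1, pos u a).
rewrite e in_setU1 eqxx => /(_ isT); rewrite mem_inv => pw.
by rewrite pw.
Qed.
End Expansion.

(** * Coefficients of Schubert polynomials *)

Section RowSupport.
Variable m : nat.
Implicit Types u w : 'S_m.

(** Equivalently, w fixes the first c positions ([rows_from_agree1]). *)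
Definition rows_from (c : nat) w :=
  [forall p in inv_set w, (c <= p.1)%N].

Lemma rows_fromP c w :
  reflect (forall i j, (i, j) \in inv_set w -> (c <= i)%N) (rows_from c w).
Proof.
apply: (iffP forall_inP) => [h i j /h //|h [i j] /h //].
Qed.

Lemma rows_from_strip c u w : strip u w -> rows_from c w -> rows_from c u.
Proof.
by move=> /andP[/subsetP s _] /rows_fromP h; apply/rows_fromP => i j /s /h.
Qed.

Lemma rows_from_leq c d w : (c <= d)%N -> rows_from d w -> rows_from c w.
Proof.
by move=> cd /rows_fromP h; apply/rows_fromP => i j /h; apply: leq_trans.
Qed.

Lemma rows_from_id c : rows_from c (1 : 'S_m)%g.
Proof. by apply/rows_fromP => i j; rewrite mem_inv !perm1; lia. Qed.

Lemma rows_from_agree1 c w : rows_from c w = agree c w 1%g.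
Proof.
apply/idP/idP => [/rows_fromP h|].
  apply/agreeP => x xc; rewrite invg1 perm1; apply: (@perm_inj _ w);
    rewrite permKV.
  apply: val_inj; rewrite /= (perm_rank w x).
  have -> : [set j | (w j < w x)%N] = [set j : 'I_m | (0 <= j < x)%N].
    apply/setP => j; rewrite !inE perm_lt_inv; case: (ltngtP x j) => // [xj|jx].
      by apply/negP => /h; rewrite leqNgt xc.
    by apply/negP => /h; rewrite leqNgt (ltn_trans jx xc).
  by rewrite card_interval ?subn0 // ltnW.
rewrite agree_sym => ag; apply/rows_fromP => i j;
  rewrite mem_inv => /andP[ij wji].
rewrite leqNgt; apply/negP => ic.
have wi : w i = i :> nat by rewrite (agree_val ag) perm1.
have wj : (w j < c)%N by rewrite (ltn_trans wji) // wi.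
by rewrite agree_sym in ag; have := agree_val ag wj; rewrite perm1 => e; lia.
Qed.

Lemma rows_from_agree c u w : rows_from c u -> rows_from c w -> agree c u w.
Proof.
rewrite !rows_from_agree1 => /agreeP h /agreeP h'; apply/agreeP => x xc.
by rewrite h ?h'.
Qed.
End RowSupport.

(** The number of chains of strips from w to the identity whose steps remove
    the numbers of inversions listed in es. *)
Fixpoint chains m (es : seq nat) (w : 'S_m) : nat :=
  if es is e :: es' then
    (\sum_(u | strip u w && (#|inv_set w :\: inv_set u| == e)) chains es' u)%N
  else (w == 1%g).

Section Coefficients.
Variable k : nat.
Let n := k.+1.
Notation R := {mpoly int[n]}.
Implicit Types (f : {ffun 'S_n -> R}) (u v w : 'S_n) (a c : nat).

(** Nothing below a permutation that fixes the first c positions can move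
    them, so the restriction on letters disappears. *)
Lemma factors_strip c (x : R) f w : rows_from c w ->
  factors c x f w = \sum_(u | strip u w) x ^+ #|inv_set w :\: inv_set u| * f u.
Proof.
move=> rw; rewrite factors_strips; apply: eq_bigl => u; rewrite /strip_from.
by apply: andb_idr => su; apply: rows_from_agree (rows_from_strip su rw) rw.
Qed.

Lemma factor_rows a c (x : R) f : (c <= a)%N -> (a < k)%N ->
  (forall w, ~~ rows_from c w -> f w = 0) ->
  forall w, ~~ rows_from c w -> factor a x f w = 0.
Proof.
move=> ca ak hf w nr; rewrite !ffunE hf // add0r; case: ifP;
  rewrite ?mulr0 // => _.
rewrite hf ?mulr0 //; apply: contraNN nr; rewrite !rows_from_agree1.
move=> /agreeP h; apply/agreeP => y yc;
  rewrite -h // invMg tpermV permM tpermD //.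
  by rewrite -val_eqE /= inordK //; lia.
by rewrite -val_eqE /= inordK //; lia.
Qed.

(** The letters that occur are at least c, so they never move the first c
    values. *)
Lemma schub_from_rows c w : (c <= n)%N -> ~~ rows_from c w ->
  schub_from k c w = 0.
Proof.
move=> cn; have [d e] : exists d, (c + d = n)%N by exists (n - c)%N; lia.
elim: d c e cn w => [|d IH] c e cn w.
  rewrite addn0 in e; rewrite /schub_from e subnn /= ffunE.
  by case: eqP => // ->; rewrite rows_from_id.
rewrite schub_fromS; last by rewrite -/n; lia.
have h v : ~~ rows_from c v -> schub_from k c.+1 v = 0.
  by move=> nr; apply: IH; try lia; apply: contraNN nr; apply: rows_from_leq.
suff: forall a f, (c <= a)%N -> (forall v, ~~ rows_from c v -> f v = 0) ->
    forall v, ~~ rows_from c v ->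
      factors a (var k c) f v = 0 by move/(_ c _ (leqnn c) h w).
move=> a; elim/(@letter_ind k): a => [a ka|a ak IHa] f ca hf v nr.
  by rewrite (factors_ge _ _ ka) hf.
rewrite (factorsS _ _ ak) IHa //; first exact: leqW.
exact: factor_rows.
Qed.

(** A step of the chain has to remove the whole row c, one box in each of the
    n - 1 - c later columns, and it cannot remove anything else since those
    columns are used up. For c = 0 this is the initial condition
    of the Schubert polynomials. *)
Lemma schub_from_staircase c w : (c <= n)%N ->
  (forall i j : 'I_n, ((i, j) \in inv_set w) = (c <= i < j)%N) ->
  schub_from k c w = \prod_(c <= i < n) var k i ^+ (n - i.+1).
Proof.
move=> cn; have [d e] : exists d, (c + d = n)%N by exists (n - c)%N; lia.
elim: d c e cn w => [|d IH] c e cn w hw.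
  rewrite addn0 in e; rewrite e big_geq // /schub_from subnn /= ffunE.
  suff -> : w = 1%g by rewrite eqxx.
  apply: inv_set_inj; apply/setP => -[i j]; rewrite hw mem_inv !perm1.
  by have := ltn_ord i; lia.
(* z fixes the first c + 1 positions and reverses the others. *)
have [|z hz] := @triangular_perm n (fun i j : 'I_n => c.+1 <= i < j)%N.
  by move=> i l j il lj /=; split; lia.
have hz' (i j : 'I_n) : ((i, j) \in inv_set z) = (c < i < j)%N.
  case: (ltnP i j) => [ij|ji]; first by rewrite (hz _ _ ij) ij andbT.

  by rewrite andbF mem_inv [(i < j)%N]ltnNge ji.
have cn' : (c < n)%N by lia.
have diff : inv_set w :\: inv_set z =
    (pair (inord c : 'I_n)) @: [set j : 'I_n | (c.+1 <= j < n)%N].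
  apply/setP => -[i j]; rewrite in_setD hz' hw; apply/idP/imsetP.
    move=> h; exists j; first by rewrite inE ltn_ord; lia.
    congr pair; apply: ord_inj; rewrite inordK //. lia.
  by case=> l; rewrite inE => h [-> ->]; rewrite inordK //; lia.
have rw : rows_from c w by apply/rows_fromP => i j; rewrite hw; lia.
have rz : rows_from c.+1 z by apply/rows_fromP => i j; rewrite hz'; lia.
rewrite schub_fromS // factors_strip // (bigD1 z) /=; last first.
  apply/andP; split.
    by apply/subsetP => -[i j]; rewrite hz' hw; lia.
  by rewrite diff; apply/column_injectiveP =>
    i i' j /imsetP[? _ [-> _]] /imsetP[? _ [-> _]].
rewrite (IH _ _ _ z) //; try lia.
rewrite diff card_imset ?card_interval //; last by move=> ? ? [].
rewrite [X in _ + X]big1 ?addr0 => [|u /andP[/andP[sub cf] nz]].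
  by rewrite [RHS]big_ltn.
rewrite schub_from_rows ?mulr0 //; apply: contraNN nz => /rows_fromP ru.
apply/eqP/inv_set_inj/setP => -[i j]; rewrite hz'.
apply/idP/idP => [h|h]; first by have := ru _ _ h; move: h; rewrite mem_inv;
  lia.
apply: contraTT isT => nij.
have h1 : (i, j) \in inv_set w :\: inv_set u by rewrite inE nij hw; lia.
have h2 : (inord c, j) \in inv_set w :\: inv_set u.
  rewrite inE hw inordK //; apply/andP; split; last by lia.
  by apply/negP => /ru; rewrite inordK // ltnn.
by have := column_injectiveP _ cf _ _ _ h1 h2 => e1; move: h;
  rewrite e1 inordK; lia.
Qed.

Lemma schubert_schub_from w : schubert w = schub_from k 0 w.
Proof.
apply: (schubert_family_unique (@schubertP n)); split.
  rewrite schub_from_staircase // => [|i j].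
    rewrite big_mkord; apply: eq_bigr => i _; by rewrite /var inord_val.
  by rewrite mem_inv !permE /=; have := ltn_ord i; have := ltn_ord j; lia.
move=> u i j ij; rewrite divdiff_schub_from // !ffunE len_swap_lt //.
Qed.

Lemma mcoeff_varM (p : R) a d (m : 'X_{1..n}) :
  (var k a ^+ d * p)@_m =
  if (d <= m (inord a))%N then p@_(m - U_(inord a) *+ d)%MM else 0.
Proof.
rewrite mulrC /var mpolyXn; set U := (U_(_) *+ d)%MM.
have UE : (U <= m)%MM = (d <= m (inord a))%N.
  apply/mnm_lepP/idP => [/(_ (inord a))|le i]; rewrite mulmnE mnm1E.
    by rewrite eqxx mul1n.
  by case: eqP => [<-|_]; rewrite ?mul1n ?mul0n.
rewrite -UE; case: ifP => [le|nle].
  by rewrite -{1}(submK le) addmC mcoeffMX.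
apply/eqP; rewrite mcoeff_eq0 (perm_mem (msuppMX _ _)); apply/mapP => -[m' _ e].
by move: nle; rewrite e lem_addr.
Qed.

(** Only the empty product of generators contributes to the constant term. *)
Lemma mcoeff_schub_from0 c w : (schub_from k c w)@_0%MM = (w == 1%g)%:R.
Proof.
rewrite /schub_from; elim: (iota _ _) => [|a s IH] /= in w *.
  by rewrite ffunE -mpolyC_nat mcoeffC eqxx mulr1.
suff h b f : (factors b (var k a) f w)@_0%MM = (f w)@_0%MM by rewrite h IH.
elim/(@letter_ind k): b f => [b kb|b bk IHb] f; first by rewrite factors_ge.
rewrite (factorsS _ _ bk) IHb ffunE mcoeffD -[var k a]expr1 mcoeff_varM.
by rewrite mnmE /= addr0.
Qed.

Lemma mcoeff_schub_from_small c w (m : 'X_{1..n}) (i : 'I_n) : (c <= n)%N ->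
  (i < c)%N -> m i != 0%N -> (schub_from k c w)@_m = 0.
Proof.
move=> cn; have [d e] : exists d, (c + d = n)%N by exists (n - c)%N; lia.
elim: d c e cn w m => [|d IH] c e cn w m ic mi.
  rewrite addn0 in e; rewrite /schub_from e subnn /= ffunE.
  rewrite -mpolyC_nat mcoeffC; case: (m =P 0%MM) => [m0|_]; rewrite ?mulr0 //.
  by rewrite m0 mnm0E in mi.
rewrite schub_fromS; last by rewrite -/n; lia.
have h v (m' : 'X_{1..n}) : m' i != 0%N -> (schub_from k c.+1 v)@_m' = 0.
  by move=> m'i; apply: IH; try lia.
elim/(@letter_ind k): {1}c (schub_from k c.+1) h w m mi =>
  [b kb|b bk IHb] f h w m mi.
  by rewrite (factors_ge _ _ kb) h.
rewrite (factorsS _ _ bk); apply: IHb => // v m' m'i.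
rewrite ffunE mcoeffD h // add0r -[var k c]expr1 mcoeff_varM.
case: ifP => // _; rewrite ffunE; case: ifP => _; rewrite ?mcoeff0 // h //.
rewrite mnmBE mulmnE mnm1E; case: (inord c =P i) => [ei|_]; rewrite ?subn0 //.
by move: ic; rewrite -ei inordK ?ltnn //; lia.
Qed.

(** The first K steps of a chain from w, which involve the variables of index
    c, ..., c + K - 1, are subject to no condition on rows because w has no
    inversion in the rows before c + K; afterwards the chain is constant since
    no further variable occurs. *)
Lemma mcoeff_schub_from K c w (m : 'X_{1..n}) : (c + K <= n)%N ->
  rows_from (c + K) w -> (forall i : 'I_n, ~~ (c <= i < c + K)%N ->
    m i = 0%N) ->
  (schub_from k c w)@_m = (chains [seq m (inord i) | i <- iota c K] w)%:R.
Proof.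
elim: K c w m => [|K IH] c w m cK rw hm.
  have -> : m = 0%MM by apply/mnmP => i; rewrite hm ?mnm0E //; lia.
  by rewrite mcoeff_schub_from0.
rewrite schub_fromS; last by lia.
rewrite factors_strip; last by apply: rows_from_leq rw; lia.
rewrite raddf_sum /= natr_sum [RHS]big_mkcondr /=; apply: eq_bigr => u su.
rewrite mcoeff_varM; set d := #|_|.
have ic : nat_of_ord (inord c : 'I_n) = c by rewrite inordK //; lia.
have [e|ne] := eqVneq d (m (inord c)); last first.
  case: ifP => // le; apply: (@mcoeff_schub_from_small _ _ _ (inord c));
    rewrite ?ic; try lia.
  rewrite mnmBE mulmnE mnm1E eqxx; lia.
rewrite -e leqnn IH; last 3 first.
- by rewrite addSnnS.
- by apply: rows_from_strip su _; rewrite addSnnS.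
- move=> i hi; rewrite mnmBE mulmnE mnm1E.
  case: (inord c =P i) => [<-|ni]; first by rewrite mul1n e subnn.
  have nic : i != c :> nat by apply: contra_notN ni => /eqP <-;
    rewrite inord_val.
  by rewrite hm //; lia.
congr (chains _ _)%:R; apply/eq_in_map => i; rewrite mem_iota => hi.
by rewrite mnmBE mulmnE mnm1E inord_eq //; lia.
Qed.
End Coefficients.

(** * Shifted permutations *)

Section Shift.
Variables N m : nat.
Implicit Types (u w : 'S_m) (i j : 'I_m).

Let sh (p : 'I_m * 'I_m) := (rshift N p.1, rshift N p.2).

Let sh_inj : injective sh.
Proof. by move=> [i j] [i' j'] [/addnI/val_inj-> /addnI/val_inj->]. Qed.

Lemma inv_set_shift w : inv_set (shift_perm N w) = sh @: inv_set w.
Proof.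
have lE (l : 'I_N) : shift_perm N w (lshift m l) = l :> nat.
  by rewrite permE /shift_fun (unsplitK (inl l)).
have rE j : shift_perm N w (rshift N j) = (N + w j)%N :> nat.
  by rewrite permE /shift_fun (unsplitK (inr j)).
apply/setP => -[x y]; apply/idP/imsetP => [|[[i j] ij [-> ->]]]; last first.
  by rewrite mem_inv !rE /= !ltn_add2l -mem_inv.
case: (split_ordP x) => i ->; case: (split_ordP y) => j ->; rewrite mem_inv.
- by rewrite !lE /=; lia.
- by rewrite lE rE /=; have := ltn_ord i; lia.
- by rewrite lE rE /=; have := ltn_ord j; lia.
- by rewrite !rE /= !ltn_add2l => h; exists (i, j); rewrite // mem_inv.
Qed.

Lemma shift_perm_inj : injective (@shift_perm N m).
Proof.
move=> w u e; apply: inv_set_inj; apply: (imset_inj sh_inj).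
by rewrite -!inv_set_shift e.
Qed.

Lemma inv_diff_shift u w :
  inv_set (shift_perm N w) :\: inv_set (shift_perm N u) =
  sh @: (inv_set w :\: inv_set u).
Proof.
rewrite !inv_set_shift; apply/setP => p; rewrite in_setD.
apply/andP/imsetP => [[nu /imsetP[q qw e]]|[q]].
  by exists q => //; rewrite inE qw andbT; apply: contraNN nu => qu;
    rewrite e imset_f.
by rewrite inE => /andP[nu qw] ->; rewrite mem_imset // imset_f.
Qed.

Lemma strip_shift u w : strip (shift_perm N u) (shift_perm N w) = strip u w.
Proof.
rewrite /strip inv_diff_shift !inv_set_shift; congr (_ && _).
  apply/idP/idP => [/subsetP h|]; last exact: imsetS.
  by apply/subsetP => p pu; rewrite -(mem_imset _ _ sh_inj) h // imset_f.
apply/column_injectiveP/column_injectiveP => h.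
  move=> i i' j h1 h2; apply: (@rshift_inj N m).
  by apply: (h _ _ (rshift N j));
    [exact: (imset_f sh h1) | exact: (imset_f sh h2)].
move=> x x' y /imsetP[[i j] h1 [-> ->]] /imsetP[[i' j']
  h2 [-> /addnI/val_inj e]].
by subst j'; rewrite (h _ _ _ h1 h2).
Qed.

(** The inversions of v are among those of the shifted w, hence all in the last
    m rows and columns, where they form the inversion set of u. *)
Lemma strip_shiftP v w : strip v (shift_perm N w) ->
  exists2 u, strip u w & v = shift_perm N u.
Proof.
move=> sv; have [|u hu] := @triangular_perm m
    (fun i j => (rshift N i, rshift N j) \in inv_set v).
  move=> i l j il lj; apply: triangular_inv_set; by rewrite /= ltn_add2l.
suff e : v = shift_perm N u by exists u; rewrite // -strip_shift -e.
apply: inv_set_inj; rewrite inv_set_shift; apply/setP => p.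
apply/idP/imsetP => [pv|[[i j] ij ->]]; last first.
  by rewrite -hu //; move: ij; rewrite mem_inv => /andP[].
have := subsetP (proj1 (andP sv)) _ pv;
  rewrite inv_set_shift => /imsetP[[i j] ij e].
exists (i, j) => //; rewrite hu -?[(_, _)]e //.
by move: ij; rewrite mem_inv => /andP[].
Qed.

Lemma chains_shift es w : chains es (shift_perm N w) = chains es w.
Proof.
elim: es w => [|e es IH] w /=.
  have <- : shift_perm N (1 : 'S_m)%g = 1%g.
    apply: inv_set_inj; rewrite inv_set_shift.
    by rewrite !inv_set1 imset0.
  by rewrite (inj_eq shift_perm_inj).
pose A := [set u | strip u w && (#|inv_set w :\: inv_set u| == e)].
rewrite (eq_bigl (mem [set shift_perm N u | u in A])) => [|v].
  rewrite big_imset /=; last by move=> ? ? _ _; apply: shift_perm_inj.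
  by apply: eq_big => [u|u _]; rewrite ?inE // IH.
rewrite /=; apply/andP/imsetP => [[sv ce]|[u]].
  have [u su ev] := strip_shiftP sv; exists u => //.
  by move: ce; rewrite inE su ev inv_diff_shift (card_imset _ sh_inj).
by rewrite inE => /andP[su /eqP ce] ->;
  rewrite strip_shift inv_diff_shift (card_imset _ sh_inj) ce.
Qed.

Lemma rows_from_shift w : rows_from N (shift_perm N w).
Proof.
apply/rows_fromP => x y; rewrite inv_set_shift => /imsetP[[i j] _ [-> _]].
exact: leq_addr.
Qed.
End Shift.

(** * Enumeration of tableaux *)

Section Fillings.
Variable m : nat.
Implicit Types (u w : 'S_m) (T : 'M[nat]_m) (i j : 'I_m).

Definition incr w T : 'M[nat]_m :=
  \matrix_(i, j) (T i j + ((i, j) \in inv_set w))%N.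

Definition entry_count T v := #|[set p : 'I_m * 'I_m | T p.1 p.2 == v]|.

Lemma incr_inj w : injective (incr w).
Proof.
move=> T T' /matrixP e; apply/matrixP => i j.
by have := e i j; rewrite !mxE => /addIn.
Qed.

(** The tableaux for w with es`_c entries equal to c + 1, built from the chain
    of superlevel sets: the boxes of Inv(w) that are not in Inv(u) get the entry
    1, and the boxes of Inv(u) get one more than in a tableau for u. *)
Fixpoint fillings (es : seq nat) w : seq 'M[nat]_m :=
  if es is e :: es' then
    flatten [seq [seq incr w T | T <- fillings es' u] |
      u <- enum [set u | strip u w && (#|inv_set w :\: inv_set u| == e)]]
  else if w == 1%g then [:: const_mx 0%N] else [::].

Lemma size_fillings es w : size (fillings es w) = chains es w.
Proof.
elim: es w => [|e es IH] w /=; first by case: eqP.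
rewrite size_flatten /shape -map_comp sumnE big_map big_enum /=.
by apply: eq_big => [u|u _]; rewrite ?inE // size_map.
Qed.

Lemma uit_incr u w T : strip u w -> is_uit u T -> is_uit w (incr w T).
Proof.
move=> /andP[/subsetP sub cf] [sh /median_triangular md cl].
have inW i j : (0 < T i j)%N -> (i, j) \in inv_set w by rewrite sh => /sub.
have pos i j : (0 < incr w T i j)%N = ((i, j) \in inv_set w).
  by rewrite mxE; have := @inW i j; case: (_ \in _) => //;
    case: (T i j) => // ? /(_ isT).
have above c i j : (c.+1 < incr w T i j)%N = (c < T i j)%N.
  rewrite mxE; have := @inW i j; case: (_ \in _); first by rewrite addn1.
  by case: (T i j) => // ? /(_ isT).
split=> // [|i i' j hi hi' nii'].
  apply/median_triangular => -[|c] i l j il lj.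
    by rewrite !pos; apply: triangular_inv_set.
  by rewrite !above; apply: md.
rewrite !mxE hi hi' (inj_eq (@addIn _)).
have [ui|nui] := boolP ((i, j) \in inv_set u);
  have [ui'|nui'] := boolP ((i', j) \in inv_set u).
- exact: cl.
- by have := sh i' j; have := sh i j; rewrite ui (negPf nui'); lia.
- by have := sh i' j; have := sh i j; rewrite ui' (negPf nui); lia.
- have e : i = i' by apply: (column_injectiveP _ cf i i' j);
  rewrite inE ?nui ?nui' ?hi ?hi'.
  by rewrite e eqxx in nii'.
Qed.

(** Subtracting 1 from the positive entries preserves the median condition,
    since its superlevel sets are superlevel sets of T; the set {T > 1} is a
    hook majority and hence the inversion set of some u. *)
Lemma uit_decr w T : is_uit w T ->
  exists u T', [/\ strip u w, is_uit u T' & T = incr w T'].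
Proof.
move=> [sh /median_triangular md cl].
have [u hu] := triangular_perm (md 1%N).
have hu' i j : ((i, j) \in inv_set u) = (1 < T i j)%N.
  have [ij|ji] := ltnP i j; first exact: hu.
  have nij : (i < j)%N = false by rewrite ltnNge ji.
  by have := sh i j; rewrite !mem_inv nij /=; lia.
exists u, (map_mx predn T); split.
- apply/andP; split.
    by apply/subsetP => -[i j]; rewrite hu' -sh; lia.
  apply/column_injectiveP => i i' j;
    rewrite !in_setD !hu' => /andP[h1 h2] /andP[h3 h4].
  apply/eqP/negPn/negP => nii'; have := cl _ _ _ h2 h4 nii'.
  by move: h2 h4; rewrite -!sh; lia.
- split=> [i j||i i' j].
  + by rewrite mxE hu'; case: (T i j) => [|[]].
  + apply/median_triangular => c i l j il lj; rewrite !mxE.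
    have e x : (c < x.-1)%N = (c.+1 < x)%N by lia.
    by rewrite !e; apply: md.
  + rewrite !hu' => h1 h2 nii'; rewrite !mxE.
    have := cl i i' j; rewrite -!sh => /(_ (ltnW h1) (ltnW h2) nii'); lia.
- by apply/matrixP => i j; rewrite !mxE -sh; case: (T i j) => // x;
  rewrite addn1.
Qed.

Lemma count_incr1 u w T : strip u w -> is_uit u T ->
  entry_count (incr w T) 1 = #|inv_set w :\: inv_set u|.
Proof.
move=> /andP[/subsetP sub _] [sh _ _]; apply: eq_card => -[i j].
rewrite in_setD inE /= mxE -[_ \in inv_set u]sh.
have : (0 < T i j)%N -> (i, j) \in inv_set w by rewrite sh => /sub.
by case: (_ \in _); case: (T i j) => [|[|t]] // /(_ isT).
Qed.

Lemma count_incrS u w T c : strip u w -> is_uit u T ->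
  entry_count (incr w T) c.+2 = entry_count T c.+1.
Proof.
move=> /andP[/subsetP sub _] [sh _ _]; apply: eq_card => -[i j].
rewrite !inE /= mxE.
have : (0 < T i j)%N -> (i, j) \in inv_set w by rewrite sh => /sub.
case: (_ \in _); first by rewrite addn1.
by case: (T i j) => // ? /(_ isT).
Qed.

Lemma mem_fillings es w T : T \in fillings es w <->
  is_uit w T /\ forall c, entry_count T c.+1 = nth 0%N es c.
Proof.
elim: es w T => [|e es IH] w T /=; last split.
- have inv1 i j : ((i, j) \in inv_set (1 : 'S_m)%g) = false.
    by rewrite inv_set1 inE.
  split.
    case: eqP => // ->; rewrite inE => /eqP ->; split; last first.
      by move=> c; rewrite nth_nil; apply: eq_card0 => p; rewrite !inE mxE.
    split=> [i j||i i' j]; rewrite ?inv1 ?mxE //.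
    apply/median_triangular => c i l j _ _.
    by rewrite !mxE.
  case=> -[sh _ _] h0; have T0 i j : T i j = 0%N.
    case Tij: (T i j) => [//|c]; have /eqP := h0 c.
    rewrite nth_nil cards_eq0 => /eqP/setP/(_ (i, j)).
    by rewrite !inE /= Tij eqxx.
  have -> : w = 1%g.
    by apply: inv_set_inj; apply/setP => -[i j]; rewrite inv1 -sh T0.
  rewrite eqxx inE; apply/eqP/matrixP => i j; by rewrite T0 mxE.
- move=> /flatten_mapP[u]; rewrite mem_enum inE => /andP[su /eqP ce].
  move=> /mapP[T' /IH[uT' cT'] ->]; split; first exact: uit_incr uT'.
  by case=> [|c]; rewrite ?(count_incr1 su uT') ?(count_incrS _ su uT') //=.
- case=> /uit_decr[u [T' [su uT' ->]]] h; apply/flatten_mapP; exists u.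
    by rewrite mem_enum inE su -(count_incr1 su uT') (h 0%N) /=.
  apply: map_f; apply/IH; split=> // c.
  by rewrite -(count_incrS _ su uT') (h c.+1).
Qed.

Lemma uniq_fillings es w : uniq (fillings es w).
Proof.
elim: es w => [|e es IH] w /=; first by case: eqP.
set s := enum _; have : uniq s := enum_uniq _;
  elim: s => //= u s IHs /andP[nus us].
rewrite cat_uniq map_inj_uniq ?IH ?IHs //=; last exact: incr_inj.
rewrite andbT; apply/hasPn => T /flatten_mapP[v vs /mapP[T1 T1v ->]].
apply/negP => /mapP[T2 T2u /incr_inj eT]; move: nus; rewrite (_ : u = v) ?vs //.
move/mem_fillings: T1v => [[sh1 _ _] _];
  move/mem_fillings: T2u => [[sh2 _ _] _].
by apply: inv_set_inj; apply/setP => -[i j]; rewrite -sh1 -sh2 eT.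
Qed.
End Fillings.

(** * The limit *)

(** A positive bound on the indices of the variables of a monomial, so that
    1^N x w acts on a nonempty set of positions when N is at least the bound. *)
Definition expo_bound (a : expo) : nat := (\max_(i <- finsupp a) i.+1)%N.+1.

Lemma expo_bound_gt (a : expo) i : i \in finsupp a -> (i < expo_bound a)%N.
Proof.
move=> ia; rewrite ltnS ltnW //.
by rewrite (big_fsetD1 i) //= leq_maxl.
Qed.

Lemma expo_out (a : expo) i : (expo_bound a <= i)%N -> a i = 0%N.
Proof.
move=> le; apply/eqP/negPn/negP; rewrite -mem_finsupp => /expo_bound_gt.
by rewrite ltnNge le.
Qed.

Definition expo_seq (a : expo) : seq nat :=
  [seq a i | i <- iota 0 (expo_bound a)].

Lemma nth_expo_seq a i : nth 0%N (expo_seq a) i = a i.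
Proof.
rewrite /expo_seq; have [lt|le] := ltnP i (expo_bound a).
  by rewrite (nth_map 0%N) ?size_iota // nth_iota.
by rewrite nth_default ?expo_out // size_map size_iota.
Qed.

Lemma coef_schubert_shift N m (w : 'S_m) (a : expo) : (expo_bound a <= N)%N ->
  fps_of_mpoly (schubert (shift_perm N w)) a = (chains (expo_seq a) w)%:R.
Proof.
(* The permutation is in S_(N + 1 + m), and N + 1 + m is convertible to
   (N + m).+1, the form required by the operators. *)
case: N => // N aN; rewrite -(chains_shift N.+1) /fps_of_mpoly.
case: forallP => [_|[]]; last first.
  by move=> [i /= ia]; have := expo_bound_gt ia; lia.
rewrite (@schubert_schub_from (N + m)%N (shift_perm N.+1 w)).
rewrite (@mcoeff_schub_from (N + m)%N (expo_bound a)) ?add0n //.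
- congr (chains _ _)%:R; apply/eq_in_map => i; rewrite mem_iota => hi.
  have hin : (i < (N + m).+1)%N by lia.
  by rewrite mnmE (inordK hin).
- by lia.
- exact: rows_from_leq aN (rows_from_shift _ _).
- by move=> i hi; rewrite mnmE expo_out // leqNgt; exact: hi.
Qed.

Theorem corollary3p20 (m : nat) (w : 'S_m) :
  exists F : fps,
    is_stanley w F /\
    fps_sum (is_uit w) (fun T : 'M[nat]_m => fps_monomial (wt T)) F.
Proof.
exists (fun a => (chains (expo_seq a) w)%:R); split=> a.
  by exists (expo_bound a) => N; apply: coef_schubert_shift.
have memE T : T \in fillings (expo_seq a) w <-> is_uit w T /\ a = wt T.
  rewrite mem_fillings; split=> -[uT h]; split=> //.
    by apply/fsfunP => c; rewrite wtE -nth_expo_seq -h.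
  by move=> c; rewrite nth_expo_seq h wtE.
exists (fillings (expo_seq a) w); split; first exact: uniq_fillings.
  move=> T; rewrite memE /fps_monomial; split=> -[uT]; first by move=> <-;
    rewrite eqxx.
  by case: (a =P wt T) => // _; rewrite eqxx.
rewrite -size_fillings -sum1_size natr_sum big_seq [RHS]big_seq.
by apply: eq_bigr => T /memE[_ <-]; rewrite /fps_monomial eqxx.
Qed.
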